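(* Let $Tr(a,y,x)$ be a relation on $\mathbb N$ with parameter $a$ which defines a family of trees on $\mathbb N$, and suppose that the elementary (first-order) theory of the structure $\mathcal M=\langle \mathbb N,\{Tr,<\}\rangle$ is decidable, where $<$ is the usual order on $\mathbb N$. Then: (i) the relation $Q(a)$, defined by ''there is an infinite branch in the tree $Tr(a,y,x)$'', is definable in $\mathcal M$; (ii) for every value of $a$, if there is an infinite branch in the tree $Tr(a,y,x)$, then there is an infinite branch in the tree $Tr(a,y,x)$ that is definable in $\mathcal M$.
   Context: A tree on $\mathbb N$ is a family of finite subsets of $\mathbb N$ (called nodes) such that if $s$ belongs to the family, then every initial segment of $s$ (with respect to the usual order $<$) belongs to the family as well. The tree is ordered by: $s\preceq s'$ iff $s$ is an initial segment of $s'$; $s\prec s'$ means $s\preceq s'$ and $s\neq s'$. The parameter $a$ may be a single natural number or a tuple of natural numbers of fixed length. The relation $Tr(a,y,x)$ defines a family of trees on $\mathbb N$ if for every value of $a$ the family $\{s^a_i : i\in\mathbb N\}$, where $s^a_i=\{y\in\mathbb N : Tr(a,y,i)\}$, is a tree; this tree is called the tree $Tr(a,y,x)$. An infinite branch in a tree is given by an infinite chain of nodes $s_1\prec s_2\prec\cdots$; it is identified with the infinite set $X=\bigcup_i s_i\subseteq\mathbb N$, all of whose finite initial segments are nodes of the tree. The branch is definable if the set $X$ is definable in $\mathcal M$. ''Definable'' means definable by a first-order formula in the signature $\{Tr,<\}$. *)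

(* Defs.v *)
From mathcomp Require Import all_boot.
From mathcomp Require Import boolp classical_sets functions cardinality.

Set Implicit Arguments.
Unset Strict Implicit.
Unset Printing Implicit Defensive.

Local Open Scope nat_scope.
Local Open Scope classical_set_scope.

(* Trees on nat *)

Definition initial_segment (s t : set nat) : Prop :=
  s `<=` t /\ forall x y : nat, t y -> y < x -> s x -> s y.

Definition strict_initial_segment (s t : set nat) : Prop :=
  initial_segment s t /\ s <> t.

Definition is_tree (F : set (set nat)) : Prop :=
  (forall s, F s -> finite_set s) /\
  (forall s t, F s -> initial_segment t s -> F t).

(* The index [i] of a node is the last argument of [Tr]; several indices may
   give the same node. *)
Definition tree_of (k : nat) (Tr : k.-tuple nat -> nat -> nat -> Prop)
    (a : k.-tuple nat) : set (set nat) :=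
  range (fun i : nat => [set y : nat | Tr a y i]).

Definition defines_family_of_trees (k : nat)
    (Tr : k.-tuple nat -> nat -> nat -> Prop) : Prop :=
  forall a : k.-tuple nat, is_tree (tree_of Tr a).

Definition infinite_branch (F : set (set nat)) (X : set nat) : Prop :=
  exists s : nat -> set nat,
    [/\ forall n, F (s n),
        forall n, strict_initial_segment (s n) (s n.+1)
      & X = \bigcup_n s n].

(* First-order logic with equality over the signature {Tr, <}.  The signature
   has no function symbols, so the only terms are variables, which are de Bruijn
   indices.  The missing connectives and the universal quantifier are the usual
   classical abbreviations. *)

Inductive formula (k : nat) : Type :=
| FEq of nat & nat
| FLt of nat & nat
| FTr of k.-tuple nat & nat & nat
| FNot of formula k
| FAnd of formula k & formula k
| FEx of formula k.

Definition env_cons (x : nat) (e : nat -> nat) : nat -> nat :=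
  fun i => if i is j.+1 then e j else x.

Fixpoint sat (k : nat) (Tr : k.-tuple nat -> nat -> nat -> Prop)
    (e : nat -> nat) (phi : formula k) : Prop :=
  match phi with
  | FEq i j => e i = e j
  | FLt i j => e i < e j
  | FTr a y x => Tr (map_tuple e a) (e y) (e x)
  | FNot f => ~ sat Tr e f
  | FAnd f g => sat Tr e f /\ sat Tr e g
  | FEx f => exists x : nat, sat Tr (env_cons x e) f
  end.

(* all free variables of [phi] have index < n *)
Fixpoint free_below (k : nat) (n : nat) (phi : formula k) : bool :=
  match phi with
  | FEq i j => (i < n) && (j < n)
  | FLt i j => (i < n) && (j < n)
  | FTr a y x => [&& all (fun i => i < n) a, y < n & x < n]
  | FNot f => free_below n f
  | FAnd f g => free_below n f && free_below n g
  | FEx f => free_below n.+1 f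
  end.

Definition sentence (k : nat) (phi : formula k) : bool := free_below 0 phi.

Definition true_in (k : nat) (Tr : k.-tuple nat -> nat -> nat -> Prop)
    (phi : formula k) : Prop :=
  forall e : nat -> nat, sat Tr e phi.

Definition definable (k : nat) (Tr : k.-tuple nat -> nat -> nat -> Prop)
    (n : nat) (R : n.-tuple nat -> Prop) : Prop :=
  exists phi : formula k,
    free_below n phi /\
    forall v : n.-tuple nat, R v <-> sat Tr (nth 0 v) phi.

Definition definable_set (k : nat) (Tr : k.-tuple nat -> nat -> nat -> Prop)
    (X : set nat) : Prop :=
  definable Tr (fun v : 1.-tuple nat => X (thead v)).

(* Partial recursive functions.  [computes f v y] says that the function
   described by [f] is defined at [v] with value [y]; primitive recursion is on
   the first argument, and minimization searches for it. *)

Inductive recfun : nat -> Type :=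
| RZero n : recfun n
| RSucc : recfun 1
| RProj n : 'I_n -> recfun n
| RComp n m : recfun m -> ('I_m -> recfun n) -> recfun n
| RPrec n : recfun n -> recfun n.+2 -> recfun n.+1
| RMin n : recfun n.+1 -> recfun n.

Fixpoint computes (n : nat) (f : recfun n) : n.-tuple nat -> nat -> Prop :=
  match f in recfun n return n.-tuple nat -> nat -> Prop with
  | RZero n => fun _ y => y = 0
  | RSucc => fun v y => y = (thead v).+1
  | RProj n i => fun v y => y = tnth v i
  | RComp n m g h => fun v y =>
      exists w : m.-tuple nat,
        (forall i, computes (h i) v (tnth w i)) /\ computes g w y
  | RPrec n g h => fun v y =>
      exists r : nat -> nat,
        [/\ computes g (behead_tuple v) (r 0),
            forall i, i < thead v ->
              computes h [tuple of i :: r i :: behead_tuple v] (r i.+1)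
          & y = r (thead v)]
  | RMin n g => fun v y =>
      computes g [tuple of y :: v] 0 /\
      forall z, z < y -> exists w, computes g [tuple of z :: v] w.+1
  end.

Definition decidable_set (A : set nat) : Prop :=
  exists f : recfun 1, forall n : nat,
    (A n -> computes f [tuple n] 1) /\ (~ A n -> computes f [tuple n] 0).

(* [CodeSeq.code] is a computable bijection from [seq nat] to [nat]. *)
Fixpoint godel (k : nat) (phi : formula k) : nat :=
  match phi with
  | FEq i j => CodeSeq.code [:: 0; i; j]
  | FLt i j => CodeSeq.code [:: 1; i; j]
  | FTr a y x => CodeSeq.code (2 :: a ++ [:: y; x])
  | FNot f => CodeSeq.code [:: 3; godel f]
  | FAnd f g => CodeSeq.code [:: 4; godel f; godel g]
  | FEx f => CodeSeq.code [:: 5; godel f]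
  end.

Definition decidable_theory (k : nat)
    (Tr : k.-tuple nat -> nat -> nat -> Prop) : Prop :=
  decidable_set
    [set godel phi | phi in [set phi : formula k | sentence phi /\ true_in Tr phi]].

(* Main.v *)
Require Import Defs.
From mathcomp Require Import all_boot.
From mathcomp Require Import boolp classical_sets functions cardinality.
From mathcomp Require Import zify.

(** Why the theorem holds.  An end-extension [u] of a finite set [t] is a jump
over [b] when all its new elements exceed [b].  Call [t] fat of order [n] in a
tree when [n] jumps, each over an arbitrarily large bound, can be made
successively from [t] inside the tree ([fat]), and say that [t] has rank at
least [n] when some node extending [t] is fat of order [n] ([rank_ge]).  For
each fixed [n] this is first-order in the tree relation and the order.  There
are two cases.

Stable case: for some [N], in every tree of the family, rank at least [N]
implies rank at least [N.+1].  Let [j] be the largest number up to [N] such that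
all nodes of a given infinite branch have rank at least [j].  Either [j] is [N],
and nodes of rank at least [N] always have proper extensions of rank at least
[N]; or some node [s] of the branch has rank exactly [j], and then above [s] the
nodes of rank at least [j] form a finitely branching tree, to which Koenig's
argument applies ([unbounded_extension]).  In both cases the nodes above [s]
with unbounded extensions of rank at least [j] form a set without maximal
elements, and the lexicographically least branch through such a set is definable
([greedy_branch], [definable_greedy_set]).  That such [j] and [s] exist is a
first-order property of the parameter, equivalent to the existence of a branch
([branch_iff_seed]).

Unstable case: for every [n] some tree of the family has a node of rank exactly
[n].  Then the theory is undecidable.  Fix bounds growing so fast that ranks
below a given size can be read off them ([sparse_scale]).  Above a node of rank
exactly [n] a path can jump over any [n] prescribed bounds ([sparse_path]) and
over no more than [n] ([sparse_drop]): such a node is a counter.  Nodes of large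
rank yield a definable set of [L] numbers, for any [L], all of whose subsets are
coded by nodes, and comparison with the counters makes equality of cardinalities
of these subsets definable ([coding_of_ranks]).  Finite sets with
equicardinality interpret computations: a number is the cardinality of a set,
and a finite sequence of numbers is a set cut into blocks by the elements of
another set ([represents_sound], [represents_complete]).  A recursive function
deciding the theory could therefore be described inside the structure, and
diagonalization refutes it ([undecidable_of_coding]). *)

Set Implicit Arguments.
Unset Strict Implicit.
Unset Printing Implicit Defensive.

Local Open Scope nat_scope.
Local Open Scope classical_set_scope.

(** * Trees, jumps and ranks *)

Lemma fin_collection (T : finType) (P : T -> nat -> Prop) :
  (forall x b c, b <= c -> P x b -> P x c) ->
  (forall x, exists b, P x b) -> exists b, forall x, P x b.
Proof.
move=> Pmono /choice[f fP]; exists (\max_x f x) => x.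
by apply: Pmono (fP x); exact: leq_bigmax.
Qed.

Lemma bounded_collection (P : nat -> nat -> Prop) (n : nat) :
  (forall i b c, b <= c -> P i b -> P i c) ->
  (forall i, i < n -> exists b, P i b) ->
  exists b, forall i, i < n -> P i b.
Proof.
move=> Pmono ex; have [|x|b bP] := @fin_collection 'I_n (fun i => P i).
- by move=> x; exact: Pmono.
- exact: ex.
- by exists b => i iN; exact: bP (Ordinal iN).
Qed.

Lemma initial_segment_refl (t : set nat) : initial_segment t t.
Proof. by split. Qed.

Lemma initial_segment_trans (s t u : set nat) :
  initial_segment s t -> initial_segment t u -> initial_segment s u.
Proof.
move=> [st st'] [tu tu']; split=> [x sx|x y uy yx sx]; first exact/tu/st.
by apply: (st' x) => //; apply: (tu' x) => //; exact: st.
Qed.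

Definition cut (b : nat) (u : set nat) : set nat := [set x | u x /\ x < b].

Lemma cut_initial_segment (b : nat) (u : set nat) :
  initial_segment (cut b u) u.
Proof.
by split=> [x []//|x y uy yx [_ xb]]; split=> //; apply: ltn_trans xb.
Qed.

Lemma initial_segment_cut (b : nat) (t u : set nat) :
  initial_segment t u -> (forall x, t x -> x < b) ->
  initial_segment t (cut b u).
Proof.
move=> [tu tu'] tb; split=> [x tx|x y [uy _]]; last exact: tu'.
by split; [exact: tu|exact: tb].
Qed.

Lemma strict_chain_unbounded (s : nat -> set nat) :
  (forall n, strict_initial_segment (s n) (s n.+1)) ->
  forall n, exists2 x, s n.+1 x & n <= x.
Proof.
move=> sS.
have new n : exists2 x, s n.+1 x & ~ s n x.
  have [[sub _] ne] := sS n; apply: contrapT => no; apply: ne.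
  by apply/seteqP; split=> // x sx; apply: contrapT => nx; apply: no; exists x.
elim=> [|n [x sx nx]]; first by have [x] := new 0; exists x.
have [z sz nsz] := new n.+1; exists z => //.
have [zx|xz|zx] := ltngtP z x; last by rewrite zx in nsz.
  by case: nsz; apply: ((sS n.+1).1.2 x).
by apply: leq_ltn_trans xz.
Qed.

(** The last clause makes the new elements lie beyond [b], not only beyond [t]. *)
Definition jump (b : nat) (t u : set nat) : Prop :=
  [/\ initial_segment t u, (exists2 y, u y & ~ t y)
    & forall y, u y -> ~ t y -> b < y].

Lemma jump_ext (b : nat) (t u v : set nat) :
  jump b t u -> initial_segment u v -> jump b t v.
Proof.
move=> [tu [y uy nty] bu] uv.
have [uvs uv'] := uv.
split; [exact: initial_segment_trans uv|by exists y => //; exact: uvs|].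
move=> z vz ntz; have [zy|yz|->] := ltngtP z y; last exact: bu.
- by apply: bu => //; apply: (uv' y).
- by apply: ltn_trans yz; exact: bu.
Qed.

Lemma jump_le (b c : nat) (t u : set nat) : b <= c -> jump c t u -> jump b t u.
Proof.
by move=> bc [tu uy cu]; split=> // y uy' nty; apply: leq_ltn_trans (cu y _ _).
Qed.

(** Each step is a jump whose new elements may form a whole block, not a single
number: the block is what leads from a node to the next fat one. *)
Fixpoint fat (F : set (set nat)) (n : nat) (t : set nat) : Prop :=
  if n is m.+1 then forall b, exists2 u, jump b t u & fat F m u else F t.

(** Passing to extensions makes the notion closed under initial segments, which
[fat] is not. *)
Definition rank_ge (F : set (set nat)) (n : nat) (t : set nat) : Prop :=
  exists2 u, initial_segment t u & fat F n u.

Section Rank.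
Variables (F : set (set nat)) (treeF : is_tree F).

Lemma fat_node n t : fat F n t -> F t.
Proof.
elim: n t => [//|n IH] t /= /(_ 0)[u [tu _ _] /IH Fu].
exact: treeF.2 Fu tu.
Qed.

Lemma fatS n t : fat F n.+1 t -> fat F n t.
Proof.
elim: n t => [|n IH] t; first exact: fat_node.
by move=> ft b; have [u jtu /IH fu] := ft b; exists u.
Qed.

Lemma rank_ge_down n s t :
  initial_segment s t -> rank_ge F n t -> rank_ge F n s.
Proof. by move=> st [u tu fu]; exists u => //; exact: initial_segment_trans tu. Qed.

Lemma rank_ge_node n t : rank_ge F n t -> F t.
Proof. by move=> [u tu /fat_node Fu]; exact: treeF.2 tu. Qed.

Lemma rank_ge0 t : F t -> rank_ge F 0 t.
Proof. by exists t => //; exact: initial_segment_refl. Qed.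

Lemma rank_ge_le m n t : m <= n -> rank_ge F n t -> rank_ge F m t.
Proof.
elim: n => [|n IH]; first by rewrite leqn0 => /eqP->.
rewrite leq_eqVlt => /orP[/eqP->//|/IH{}IH [u tu /fatS fu]].
by apply: IH; exists u.
Qed.

Lemma node_bound t : F t -> exists b, forall x, t x -> x < b.
Proof.
move=> /treeF.1/finite_seqP[s ->]; exists (\max_(x <- s) x).+1 => x /= xs.
by rewrite ltnS (big_rem x) //= leq_maxl.
Qed.

Definition unbounded_above (j : nat) (t : set nat) : Prop :=
  forall b, exists u, [/\ initial_segment t u, rank_ge F j u
                        & exists2 y, u y & b < y].

Lemma unbounded_aboveW j t : unbounded_above j t -> rank_ge F j t.
Proof. by move=> /(_ 0)[u [tu ru _]]; apply: rank_ge_down ru. Qed.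

Lemma rankS_unbounded j t : rank_ge F j.+1 t -> unbounded_above j t.
Proof.
move=> [u tu fu] b; have [v juv fv] := fu b.
have [uv [y vy nuy] bv] := juv.
exists v; split; first exact: initial_segment_trans uv.
  by exists v => //; exact: initial_segment_refl.
by exists y => //; exact: bv.
Qed.

(** Koenig's argument.  If [s] has rank less than [j.+1], no extension [t] of [s]
is fat of order [j.+1], so the first new element of an extension of [t] of rank
at least [j] is bounded by some [b0].  If none of the finitely many one-element
extensions up to [b0] had unbounded extensions of rank at least [j], neither
would [t]. *)
Lemma unbounded_extension j s t :
  ~ rank_ge F j.+1 s \/ (forall u, rank_ge F j u -> rank_ge F j.+1 u) ->
  initial_segment s t -> unbounded_above j t ->
  exists u, [/\ initial_segment t u, (exists2 y, u y & ~ t y)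
              & unbounded_above j u].
Proof.
move=> [nrs|rS] st ut; last first.
  have [u tu fu] := rS _ (unbounded_aboveW ut).
  have [v [uv [y vy nuy] _] fv] := fu 0.
  exists v; split; first exact: initial_segment_trans uv.
    by exists y => // /tu.1.
  by apply/rankS_unbounded/rS; exists v => //; exact: initial_segment_refl.
have Ft := rank_ge_node (unbounded_aboveW ut).
have nft : ~ fat F j.+1 t by move=> ft; apply: nrs; exists t.
have [b0 b0P] : exists b0, ~ exists2 u, jump b0 t u & fat F j u.
  exact/existsNP.
have {}b0P u : jump b0 t u -> ~ rank_ge F j u.
  move=> jtu [v uv fv]; apply: b0P; exists v => //; exact: jump_ext uv.
apply: contrapT => noext.
have [c cP] := node_bound Ft.
(* Q y b: the extensions of rank j of t with y added stay below b *)
pose Q y b := forall u, initial_segment t u -> ~ t y ->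
  initial_segment [set x | t x \/ x = y] u -> rank_ge F j u ->
  forall z, u z -> z <= b.
have [//||B BP] := @bounded_collection Q b0.+1.
- by move=> i b d bd Qb u tu nti iu ru z uz; apply: leq_trans bd; apply: Qb uz.
- move=> y _; apply: contrapT => /forallNP nb.
  have nb' b : exists u, [/\ initial_segment t u, ~ t y,
     initial_segment [set x | t x \/ x = y] u, rank_ge F j u
     & exists2 z, u z & b < z].
    apply: contrapT => nu; apply: (nb b) => u tu nty yu ru z uz.
    rewrite leqNgt; apply/negP => bz; apply: nu; exists u; split => //.
    by exists z.
  apply: noext; exists [set x | t x \/ x = y]; split.
  + have [u [tu nty yu _ _]] := nb' 0; split=> [x tx|x z]; first by left.
    by move=> tz zx tx; apply: (tu.2 x) => //; apply: yu.1.
  + have [u [_ nty _ _ _]] := nb' 0; by exists y => //; right.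
  + by move=> b; have [u [_ _ ? ? ?]] := nb' b; exists u.
have [u [tu ru [z uz zB]]] := ut (maxn B (maxn b0 c)).
have ntz : ~ t z by move=> /cP; lia.
have exd : exists y, `[< u y /\ ~ t y >] by exists z; apply/asboolP.
case: (ex_minnP exd) => y /asboolP[uy nty] ymin.
have yfirst x : u x -> ~ t x -> y <= x.
  by move=> ux ntx; apply: ymin; apply/asboolP.
have [yb|by0] := leqP y b0.
  have := BP y yb u tu nty _ ru z uz.
  suff: initial_segment [set x | t x \/ x = y] u by move=> iu /(_ iu); lia.
  split=> [x [tx|->//]|x x' ux' x'x]; first exact: tu.1.
  case=> [tx|xy]; first by left; apply: (tu.2 x).
  left; apply: contrapT => ntx'; have := yfirst _ ux' ntx'; lia.
apply: b0P ru; split=> //; first by exists z.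
by move=> x ux ntx; apply: leq_trans by0 _; exact: yfirst.
Qed.

End Rank.

(** * Lexicographically least branches *)

Lemma chain_branch (F G : set (set nat)) :
  G `<=` F -> G !=set0 ->
  (forall s t, G s -> G t -> initial_segment s t \/ initial_segment t s) ->
  (forall t, G t -> exists u, [/\ G u, initial_segment t u & u <> t]) ->
  infinite_branch F (\bigcup_(t in G) t).
Proof.
move=> GF [t0 Gt0] Gc Gext.
have /choice[nxt nxtP] : forall t, exists u, G t ->
    [/\ G u, initial_segment t u & u <> t].
  move=> t; have [/Gext[u Pu]|nG] := pselect (G t); first by exists u.
  by exists t.
pose s n := iter n nxt t0.
have Gs n : G (s n) by elim: n => //= n /nxtP[].
have sS n : strict_initial_segment (s n) (s n.+1).
  by have [_ ? ne] := nxtP _ (Gs n); split=> // /esym.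
have big := strict_chain_unbounded sS.
exists s; split=> // [n|]; first exact: GF.
apply/seteqP; split=> x; last by case=> n _ sx; exists (s n).
case=> t Gt tx; have [z sz xz] := big x.+1.
case: (Gc _ _ Gt (Gs x.+2)) => [[ts _]|[_ ts]].
  by exists x.+2 => //; exact: ts.
by exists x.+2 => //; apply: (ts z).
Qed.

(** [t] extends to a member of [E], and no member of [E] that agrees with [t]
below [z'] contains a [z'] skipped by [t]: every element of [t] is the least
possible continuation of the preceding ones.  This refers to no enumeration of
the branch, so it is first-order when [E] is. *)
Definition greedy (E : set (set nat)) (t : set nat) : Prop :=
  (exists2 u, E u & initial_segment t u) /\
  forall z z' v, t z -> z' < z -> ~ t z' -> E v -> v z' ->
    exists2 y, y < z' & ~ (v y <-> t y).

(** Two greedy sets are comparable: at their first difference, the one without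
the new element cannot contain anything larger.  A greedy set is extended by the
least number that continues it inside [E]. *)
Lemma greedy_branch (F E : set (set nat)) (s : set nat) : is_tree F ->
  E `<=` F -> E s ->
  (forall t, E t -> exists u, [/\ E u, initial_segment t u & exists2 y, u y & ~ t y]) ->
  infinite_branch F (\bigcup_(t in greedy E) t).
Proof.
move=> treeF EF Es Eext; apply: chain_branch.
- by move=> t [[u Eu tu] _]; apply: treeF.2 tu; exact: EF.
- exists set0; split; last by [].
  by exists s => //; split.
- have key s1 t1 : greedy E s1 -> greedy E t1 ->
      (exists y, [/\ s1 y, ~ t1 y & forall x, x < y -> s1 x <-> t1 x]) ->
      initial_segment t1 s1.
    move=> [[u1 Eu1 su1] _] [_ gt] [y [sy nty yP]].
    have tlt x : t1 x -> x < y.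
      move=> tx; have [//|yx|xy] := ltngtP x y; last by rewrite xy in tx.
      have [x' x'y] := gt x y u1 tx yx nty Eu1 (su1.1 _ sy).
      case; rewrite -yP //; split=> [ux'|]; last exact: su1.1.
      exact: (su1.2 y).
    split=> [x tx|x x' sx' x'x tx]; first by apply/yP => //; exact: tlt.
    by apply/yP => //; apply: ltn_trans (tlt x _).
  move=> s1 t1 gs gt.
  have [st|ne] := pselect (forall x, s1 x <-> t1 x).
    by left; split=> [x /st//|x y /st sy].
  have exd : exists x, ~~ `[< s1 x <-> t1 x >].
    by move/existsNP: ne => [x xP]; exists x; apply/asboolPn.
  case: (ex_minnP exd) => y /asboolPn yd ymin.
  have yP x : x < y -> s1 x <-> t1 x.
    by move=> xy; apply: contrapT => /asboolPn /ymin; rewrite leqNgt xy.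
  have [sy|nsy] := pselect (s1 y).
    by right; apply: key => //; exists y; split=> // ty; exact: yd.
  left; apply: key => //; exists y; split=> //; last by move=> x /yP ?; tauto.
  by apply: contrapT => nty; exact: yd.
- move=> t [[u Eu tu] gt].
  have exz : exists z, `[< exists v, [/\ E v, initial_segment t v, v z & ~ t z] >].
    have [v [Ev uv [z vz nuz]]] := Eext _ Eu.
    exists z; apply/asboolP; exists v; split=> //.
      exact: initial_segment_trans uv.
    by move=> /tu.1.
  case: (ex_minnP exz) => z /asboolP[v [Ev tv vz ntz]] zmin.
  have below x : v x -> x < z -> t x.
    move=> vx xz; apply: contrapT => ntx.
    suff: z <= x by rewrite leqNgt xz.
    by apply: zmin; apply/asboolP; exists v.
  have tz x : t x -> x < z.
    move=> tx; have [//|zx|xz] := ltngtP x z; last by rewrite xz in tx.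
    by case: ntz; apply: (tv.2 x).
  exists [set x | t x \/ x = z]; split.
  + split.
      exists v => //; split=> [x [/tv.1//|->//]|x y vy yx [tx|xz]].
        by left; apply: (tv.2 x).
      by left; apply: below => //; rewrite -xz.
    move=> x y v' tx yx nty Ev' v'y.
    have nty1 : ~ t y by move=> ty; apply: nty; left.
    have nyz : y <> z by move=> yz; apply: nty; right.
    have lift : (exists2 w, w < y & ~ (v' w <-> t w)) ->
        exists2 w, w < y & ~ (v' w <-> (t w \/ w = z)).
      move=> [w wy nw]; exists w => // iw; apply: nw.
      have wz : w <> z.
        case: tx => [/tz|]; lia.
      by split=> [/iw[]//|tw]; apply/iw; left.
    apply: lift; case: tx => [tx|xz]; first exact: (gt x).
    apply: contrapT => nw.
    have agree w : w < y -> v' w <-> t w.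
      by move=> wy; apply: contrapT => ?; apply: nw; exists w.
    have [[x' tx' yx']|nox] := pselect (exists2 x', t x' & y < x').
      have [w wy] := gt x' y v' tx' yx' nty1 Ev' v'y.
      by case; exact: agree.
    have ty x' : t x' -> x' < y.
      move=> tx'; have [//|yx'|xy'] := ltngtP x' y.
        by case: nox; exists x'.
      by rewrite xy' in tx'.
    suff: z <= y by lia.
    apply: zmin; apply/asboolP; exists v'; split=> //.
    split=> [x' tx'|x' y' vy' yx' tx']; first by apply/agree => //; exact: ty.
    by apply/agree => //; apply: ltn_trans (ty x' _).
  + by split=> [x tx|x y [//|->] zx tx]; [left|have := tz _ tx; lia].
  + by move=> e; apply: ntz; rewrite -e; right.
Qed.

(** A certificate for an infinite branch through [s]; the first clause is the
reason why nodes of rank at least [j] branch finitely above [s]. *)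
Definition branch_seed (F : set (set nat)) (N j : nat) (s : set nat) : Prop :=
  (j < N -> ~ rank_ge F j.+1 s) /\ unbounded_above F j s.

(** [j] is the largest number up to [N] such that all nodes of the branch have
rank at least [j], and [s] is a node of the branch that shows its maximality. *)
Lemma branch_seed_ex (F : set (set nat)) (X : set nat) (N : nat) : is_tree F ->
  infinite_branch F X -> exists2 j, j <= N & exists2 s, F s & branch_seed F N j s.
Proof.
move=> treeF [s [Fs sS _]].
have sle m n : m <= n -> initial_segment (s m) (s n).
  elim: n => [|n IH]; first by rewrite leqn0 => /eqP->; exact: initial_segment_refl.
  rewrite leq_eqVlt => /orP[/eqP->|/IH sn]; first exact: initial_segment_refl.
  exact: initial_segment_trans (sS n).1.
have big := strict_chain_unbounded sS.
have unb j : (forall n, rank_ge F j (s n)) -> forall n, unbounded_above F j (s n).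
  move=> rj n b; have [x sx bx] := big b.+1.
  exists (s (maxn n b.+2)); split => //; first by apply: sle; exact: leq_maxl.
  by exists x => //; apply: (sle b.+2 _ _).1 => //; exact: leq_maxr.
have [all_N|] := pselect (forall n, rank_ge F N (s n)).
  exists N => //; exists (s 0) => //; split; first by rewrite ltnn.
  exact: unb.
move=> /existsNP bad.
have ex : exists j, `[< exists n, ~ rank_ge F j (s n) >] by exists N; apply/asboolP.
case: (ex_minnP ex) => -[|j] /asboolP[n nr] jmin.
  by case: nr; exact: rank_ge0.
have jN : j.+1 <= N by apply: jmin; exact/asboolP.
exists j; first exact: ltnW.
exists (s n) => //; split=> //; apply: unb => n'; apply: contrapT => nr'.
by have /jmin : `[< exists n, ~ rank_ge F j (s n) >] by [apply/asboolP; exists n']; rewrite ltnn.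
Qed.

(** * First-order definable predicates *)

Definition env_app (q : nat) (w : 'I_q -> nat) (e : nat -> nat) : nat -> nat :=
  fun i => if insub i is Some j then w j else e (i - q).

Lemma env_app_lo (q : nat) (w : 'I_q -> nat) e (i : 'I_q) : env_app w e i = w i.
Proof. by rewrite /env_app valK. Qed.

Lemma env_app_hi (q : nat) (w : 'I_q -> nat) e (i : nat) : env_app w e (q + i) = e i.
Proof. by rewrite /env_app insubF ?addKn //; lia. Qed.

Definition cons_vec (T : Type) (n : nat) (x : T) (s : 'I_n -> T) : 'I_n.+1 -> T :=
  fun i => oapp s x (unlift ord0 i).

Lemma cons_vec0 (T : Type) (n : nat) (x : T) (s : 'I_n -> T) :
  cons_vec x s ord0 = x.
Proof. by rewrite /cons_vec unlift_none. Qed.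

Lemma cons_vecS (T : Type) (n : nat) (x : T) (s : 'I_n -> T) i :
  cons_vec x s (lift ord0 i) = s i.
Proof. by rewrite /cons_vec liftK. Qed.

Lemma cons_vec_comp (T U : Type) (f : T -> U) (n : nat) (x : T) (s : 'I_n -> T) i :
  f (cons_vec x s i) = cons_vec (f x) (f \o s) i.
Proof. by rewrite /cons_vec; case: unlift. Qed.

Fixpoint FExs (k q : nat) (phi : formula k) : formula k :=
  if q is q'.+1 then FEx (FExs q' phi) else phi.

(** Under a block of quantifiers the outermost one binds the last variable. *)
Lemma env_appS (q : nat) (w : 'I_q -> nat) x e :
  env_app w (env_cons x e) = env_app (fun i : 'I_q.+1 => oapp w x (unlift ord_max i)) e.
Proof.
apply/funext => i; rewrite {2}/env_app; case: insubP => [j iq ji|iq].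
  rewrite -ji; case: (unliftP ord_max j) => [j' ->|->] /=.
    by rewrite -(env_app_lo w (env_cons x e)) -[in RHS]lift_max.
  by have := env_app_hi w (env_cons x e) 0; rewrite addn0.
have -> : i = q + (i - q.+1).+1 by lia.
by rewrite env_app_hi /=; congr e; lia.
Qed.

Lemma sat_FExs (k : nat) Tr (q : nat) (phi : formula k) e :
  sat Tr e (FExs q phi) <-> exists w : 'I_q -> nat, sat Tr (env_app w e) phi.
Proof.
elim: q e => [|q IH] e /=.
  have E w : env_app (q := 0) w e = e.
    by apply/funext => i; rewrite /env_app insubF //= subn0.
  by split=> [h|[w]]; rewrite ?E //; exists (fun=> 0); rewrite E.
split=> [[x /IH[w]]|[w h]].
  by rewrite env_appS => h; eexists; exact: h.
exists (w ord_max); apply/IH; exists (fun i => w (lift ord_max i)).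
rewrite env_appS.
suff -> : (fun i => oapp (fun i0 => w (lift ord_max i0)) (w ord_max) (unlift ord_max i)) = w by [].
by apply/funext => i; case: unliftP => [j ->|->].
Qed.

Lemma free_FExs (k q n : nat) (phi : formula k) :
  free_below n (FExs q phi) = free_below (q + n) phi.
Proof. by elim: q n => //= q IH n; rewrite IH addnS. Qed.

Lemma free_below_le (k m n : nat) (phi : formula k) :
  m <= n -> free_below m phi -> free_below n phi.
Proof.
elim: phi m n => [i j|i j|a y x|f IH|f IHf g IHg|f IH] m n mn /=.
- by move=> /andP[]; lia.
- by move=> /andP[]; lia.
- move=> /and3P[/allP am ym xm]; apply/and3P; split; [|lia|lia].
  by apply/allP => i /am; lia.
- exact: IH.
- by move=> /andP[/(IHf _ _ mn)-> /(IHg _ _ mn)->].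
- exact: IH.
Qed.

(** Definability is proved for predicates on environments, whose arguments are
the values [e i]; the closure lemmas then follow the shape of a Coq proposition,
and under a binder [e i] becomes [e i.+1]. *)

Section Definability.
Variables (k : nat) (Tr : k.-tuple nat -> nat -> nat -> Prop).

Definition defpred (n : nat) (R : (nat -> nat) -> Prop) : Prop :=
  exists phi : formula k, free_below n phi /\ forall e, R e <-> sat Tr e phi.

Lemma def_ext n (R R' : (nat -> nat) -> Prop) :
  (forall e, R e <-> R' e) -> defpred n R' -> defpred n R.
Proof. by move=> RR' [phi [fr h]]; exists phi; split=> // e; rewrite RR'. Qed.

Lemma def_eq n i j : i < n -> j < n -> defpred n (fun e => e i = e j).
Proof. by move=> iN jN; exists (FEq _ i j) => /=; rewrite iN jN. Qed.

Lemma def_lt n i j : i < n -> j < n -> defpred n (fun e => is_true (e i < e j)).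
Proof. by move=> iN jN; exists (FLt _ i j) => /=; rewrite iN jN. Qed.

Lemma def_Tr n (a : 'I_k -> nat) y x :
  (forall i, a i < n) -> y < n -> x < n ->
  defpred n (fun e => Tr [tuple e (a i) | i < k] (e y) (e x)).
Proof.
move=> aN yN xN; exists (FTr [tuple a i | i < k] y x); split=> /=.
  by rewrite yN xN !andbT; apply/allP => _ /mapP[i _ ->].
move=> e; suff -> : map_tuple e [tuple a i | i < k] = [tuple e (a i) | i < k] by [].
by apply: eq_from_tnth => i; rewrite tnth_map !tnth_mktuple.
Qed.

Lemma def_not n R : defpred n R -> defpred n (fun e => ~ R e).
Proof. by move=> [f [fr h]]; exists (FNot f); split=> //= e; rewrite h. Qed.

Lemma def_and n R S : defpred n R -> defpred n S -> defpred n (fun e => R e /\ S e).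
Proof.
move=> [f [fr h]] [g [gr h']]; exists (FAnd f g); split=> /= [|e]; first exact/andP.
by rewrite h h'.
Qed.

Lemma def_imp n R S : defpred n R -> defpred n S -> defpred n (fun e => R e -> S e).
Proof.
move=> dR dS; apply: (@def_ext _ _ (fun e => ~ (R e /\ ~ S e))).
  by move=> e; split=> [h [/h]//|h r]; apply: contrapT => ns; apply: h.
by apply/def_not/def_and => //; exact/def_not.
Qed.

Lemma def_or n R S : defpred n R -> defpred n S -> defpred n (fun e => R e \/ S e).
Proof.
move=> dR dS; apply: (@def_ext _ _ (fun e => ~ R e -> S e)).
  by move=> e; have := EM (R e); tauto.
by apply: def_imp => //; exact: def_not.
Qed.

Lemma def_iff n R S : defpred n R -> defpred n S -> defpred n (fun e => R e <-> S e).
Proof. by move=> dR dS; apply: def_and; exact: def_imp. Qed.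

Lemma def_ex n (Q : nat -> (nat -> nat) -> Prop) :
  defpred n.+1 (fun e => Q (e 0) (fun i => e i.+1)) ->
  defpred n (fun e => exists x, Q x e).
Proof.
move=> [f [fr h]]; exists (FEx f); split=> //= e.
have E x : Q x e <-> sat Tr (env_cons x e) f by exact: (h (env_cons x e)).
by split=> -[x /E Qx]; exists x.
Qed.

Lemma def_all n (Q : nat -> (nat -> nat) -> Prop) :
  defpred n.+1 (fun e => Q (e 0) (fun i => e i.+1)) ->
  defpred n (fun e => forall x, Q x e).
Proof.
move=> dQ; apply: (@def_ext _ _ (fun e => ~ exists x, ~ Q x e)).
  by move=> e; split=> [h [x]//|/forallNP h x]; exact: contrapT.
by apply/def_not/def_ex; exact/def_not.
Qed.

Lemma def_exv n q (Q : ('I_q -> nat) -> (nat -> nat) -> Prop) :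
  defpred (q + n) (fun e => Q (fun i => e i) (fun i => e (q + i))) ->
  defpred n (fun e => exists w, Q w e).
Proof.
move=> [f [fr h]]; exists (FExs q f); rewrite free_FExs; split=> // e.
have E w : Q w e <-> sat Tr (env_app w e) f.
  rewrite -h.
  have -> : (fun i : 'I_q => env_app w e i) = w by apply/funext => i; rewrite env_app_lo.
  by have -> : (fun i => env_app w e (q + i)) = e
    by apply/funext => i; rewrite env_app_hi.
by rewrite sat_FExs; split=> -[w /E ?]; exists w.
Qed.

Lemma def_allv n q (Q : ('I_q -> nat) -> (nat -> nat) -> Prop) :
  defpred (q + n) (fun e => Q (fun i => e i) (fun i => e (q + i))) ->
  defpred n (fun e => forall w, Q w e).
Proof.
move=> dQ; apply: (@def_ext _ _ (fun e => ~ exists x, ~ Q x e)).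
  by move=> e; split=> [h [x]//|/forallNP h x]; exact: contrapT.
by apply/def_not/def_exv; exact/def_not.
Qed.

Lemma def_true n : defpred n (fun=> True).
Proof.
apply: (@def_ext _ _ (fun e => forall x, x = x)); first by [].
by apply: def_all; exact: def_eq.
Qed.

Lemma def_const n (P : Prop) : defpred n (fun=> P).
Proof.
have [p|np] := pselect P.
  by apply: def_ext (def_true n).
by apply: def_ext (def_not (def_true n)) => e; tauto.
Qed.

Lemma def_all_ord n q (R : 'I_q -> (nat -> nat) -> Prop) :
  (forall i, defpred n (R i)) -> defpred n (fun e => forall i, R i e).
Proof.
elim: q R => [|q IH] R dR.
  by apply: def_ext (def_true n) => e; split=> // _ [].
apply: (@def_ext _ _ (fun e => R ord0 e /\ forall i, R (lift ord0 i) e)).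
  move=> e; split=> [h|[h0 hS] i]; first by split.
  by case: (unliftP ord0 i) => [j ->|->].
by apply: def_and => //; apply: IH.
Qed.

Lemma def_exn n (N : nat) (R : nat -> (nat -> nat) -> Prop) :
  (forall j, defpred n (R j)) -> defpred n (fun e => exists2 j, j < N & R j e).
Proof.
move=> dR; elim: N => [|N IH].
  by apply: def_ext (def_const n False) => e; split=> // -[].
apply: def_ext (def_or (dR N) IH) => e; split.
  by case=> j; rewrite ltnS leq_eqVlt => /orP[/eqP->|jN r]; [left|right; exists j].
by case=> [r|[j jN r]]; [exists N|exists j => //; exact: ltnW].
Qed.

(** Every number is definable from the order, being determined by its
predecessors. *)
Lemma def_num n (c : nat) i : i < n -> defpred n (fun e => e i = c).
Proof.
elim: c n i => [|c IH] n i iN.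
  apply: (@def_ext _ _ (fun e => ~ exists x, is_true (x < e i))).
    by move=> e; split=> [-> [x]//|h]; case: (e i) h => // m []; exists 0.
  by apply/def_not/def_ex; exact: def_lt.
apply: (@def_ext _ _ (fun e => exists x, x = c /\ (is_true (x < e i) /\
    ~ exists y, is_true (x < y) /\ is_true (y < e i)))).
  move=> e; split=> [->|[x [-> [h no]]]].
    by exists c; split=> //; split=> // -[y []]; lia.
  by apply/eqP; rewrite eqn_leq h andbT leqNgt; apply/negP => h'; apply: no; exists c.+1.
apply: def_ex; apply: def_and; first exact: IH.
apply: def_and; first exact: def_lt.
apply/def_not/def_ex; apply: def_and; exact: def_lt.
Qed.

(** Hence fixed numbers may replace parameters in a definable predicate. *)
Lemma def_subst_num n q (c : 'I_q -> nat) (Q : ('I_q -> nat) -> (nat -> nat) -> Prop) :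
  defpred (q + n) (fun e => Q (fun i => e i) (fun i => e (q + i))) ->
  defpred n (fun e => Q c e).
Proof.
move=> dQ; apply: (@def_ext _ _ (fun e => exists w : 'I_q -> nat, (forall i, w i = c i) /\ Q w e)).
  move=> e; split=> [h|[w [/funext<-]//]]; by exists c.
apply: def_exv; apply: def_and => //; apply: def_all_ord => i.
by apply: def_num; have := ltn_ord i; lia.
Qed.

End Definability.

Ltac def_bound := solve [move=> *; rewrite ?ltnS;
  first [assumption | match goal with H : forall _, _ |- _ => exact: H end | lia]].

Ltac def_logic :=
  first [apply: def_lt; def_bound | apply: def_eq; def_bound
       | match goal with
         | |- defpred _ _ (fun e => ~ _) => apply: def_not
         | |- defpred _ _ (fun e => _ /\ _) => apply: def_and
         | |- defpred _ _ (fun e => _ \/ _) => apply: def_or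
         | |- defpred _ _ (fun e => _ <-> _) => apply: def_iff
         | |- defpred _ _ (fun e => exists x : nat, _) => apply: def_ex
         | |- defpred _ _ (fun e => forall x : nat, _) => apply: def_all
         | |- defpred _ _ (fun e => _ -> _) => apply: def_imp
         end].

(** * Codings of the subsets of a finite set *)

Definition has_card (X : nat -> Prop) (n : nat) : Prop :=
  exists l : seq nat, [/\ uniq l, size l = n & forall j, X j <-> j \in l].

Lemma has_card_ext X Y n : (forall j, X j <-> Y j) -> has_card X n -> has_card Y n.
Proof. by move=> XY [l [ul sl lP]]; exists l; split=> // j; rewrite -XY. Qed.

Lemma has_card_le X Y m n :
  (forall j, X j -> Y j) -> has_card X m -> has_card Y n -> m <= n.
Proof.
move=> XY [l [ul <- lP]] [l' [_ <- lP']]; apply: uniq_leq_size => // j /lP/XY.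
by rewrite lP'.
Qed.

Lemma has_card_inj X m n : has_card X m -> has_card X n -> m = n.
Proof. by move=> Xm Xn; apply/eqP; rewrite eqn_leq !(@has_card_le X X). Qed.

Lemma has_card_bounded X b : (forall j, X j -> j < b) -> exists n, has_card X n.
Proof.
move=> Xb; exists (size [seq j <- iota 0 b | `[< X j >]]).
exists [seq j <- iota 0 b | `[< X j >]]; split=> //.
  by rewrite filter_uniq ?iota_uniq.
move=> j; rewrite mem_filter mem_iota; split=> [Xj|/andP[/asboolP//]].
by apply/andP; split; [exact/asboolP|have := Xb _ Xj; lia].
Qed.

Lemma has_card0 X : has_card X 0 <-> forall j, ~ X j.
Proof.
split=> [[l [_ /size0nil-> lP]] j|X0]; first by rewrite lP.
by exists [::]; split=> // j; split=> // /X0.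
Qed.

Lemma has_cardS X n y : X y -> has_card X n.+1 <-> has_card (fun j => X j /\ j <> y) n.
Proof.
move=> Xy; split=> -[l [ul sl lP]].
  have yl : y \in l by apply/lP.
  exists (rem y l); split; first exact: rem_uniq.
    by rewrite size_rem // sl.
  move=> j; rewrite (rem_filter _ ul) mem_filter /=.
  by split=> [[/lP-> /eqP ->]//|/andP[/eqP ? /lP]].
exists (y :: l); split=> /=; last 1 first.
- move=> j; rewrite inE; split=> [Xj|/orP[/eqP->//|/lP[]//]].
  by have [//|/eqP jy] := eqVneq j y; apply/lP.
- by rewrite ul andbT; apply/negP => /lP[].
- by rewrite sl.
Qed.

Lemma has_card_lt X Y m n y :
  (forall j, X j -> Y j) -> Y y -> ~ X y -> has_card X m -> has_card Y n -> m < n.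
Proof.
case: n => [|n] XY Yy nXy cX cY; first by move/has_card0: cY => /(_ y).
move/(has_cardS _ Yy): cY => cY; apply: has_card_le cX cY => j Xj.
by split=> [|jy]; [exact: XY|rewrite jy in Xj].
Qed.

Lemma has_card_sub Y m n : has_card Y n -> m <= n ->
  exists X : nat -> Prop, (forall j, X j -> Y j) /\ has_card X m.
Proof.
move=> [l [ul sl lP]] mn; exists (fun j => j \in take m l); split.
  by move=> j /mem_take; rewrite lP.
exists (take m l); split=> //; first exact: take_uniq.
by rewrite size_takel // sl.
Qed.

Lemma has_card_nonempty X n : has_card X n.+1 -> exists j, X j.
Proof.
by case=> -[|x l] [_ // _ lP]; exists x; apply/lP; rewrite inE eqxx.
Qed.

Section Coding.
Variables (m : nat) (mem eqc : ('I_m -> nat) -> nat -> nat -> Prop).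

(** [mem p s] is the set coded by [s], for the parameters [p].  Finitely many
numbers occur in coded sets, all sets of such numbers are coded, and [eqc]
compares cardinalities. *)
Definition set_coding (p : 'I_m -> nat) : Prop :=
  [/\ exists b, forall s j, mem p s j -> j < b,
      forall B : nat -> Prop, (forall j, B j -> exists s, mem p s j) ->
        exists s, forall j, mem p s j <-> B j
    & forall s t, eqc p s t <-> exists2 n, has_card (mem p s) n & has_card (mem p t) n].

Definition isempty p s : Prop := forall j, ~ mem p s j.

Definition removal p r s j : Prop :=
  mem p s j /\ forall x, mem p r x <-> mem p s x /\ x <> j.

(** The same property without quantification over sets: closure under adding an
element gives all finite sets by induction, and the recursion that removes one
element from each side determines [eqc]. *)
Definition set_coding_fo (p : 'I_m -> nat) : Prop :=
  (exists b, forall s j, mem p s j -> j < b) /\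
  ((exists s, isempty p s) /\
  ((forall s t j, mem p t j -> exists u, forall x, mem p u x <-> mem p s x \/ x = j) /\
  (forall s t, eqc p s t <-> (isempty p s /\ isempty p t) \/
    exists j r i q, removal p r s j /\ (removal p q t i /\ eqc p r q)))).

Lemma set_codingP p : set_coding p <-> set_coding_fo p.
Proof.
split=> [[[b pb] pall peq]|[[b pb] [[s0 s0P] [pins peq]]]].
  split; first by exists b.
  split.
    by have [|s sP] := pall (fun=> False); last by exists s => j /sP.
  split.
    move=> s t j tj; have [|u uP] := pall (fun x => mem p s x \/ x = j).
      by move=> x [sx|->]; [exists s|exists t].
    by exists u.
  move=> s t; rewrite peq; split.
    case=> -[|n] cs ct.
      by left; split; apply/has_card0.
    right; have [j sj] := has_card_nonempty cs; have [i ti] := has_card_nonempty ct.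
    have [x [sx _]|r rP] := pall (fun x => mem p s x /\ x <> j); first by exists s.
    have [x [sx _]|q qP] := pall (fun x => mem p t x /\ x <> i); first by exists t.
    exists j, r, i, q; split; first by split.
    split; first by split.
    apply/peq; exists n.
      by move/(has_cardS _ sj): cs; apply: has_card_ext => x; rewrite rP.
    by move/(has_cardS _ ti): ct; apply: has_card_ext => x; rewrite qP.
  case=> [[/has_card0 s0 /has_card0 t0]|]; first by exists 0.
  case=> j [r] [i] [q] [[sj rP] [[ti qP] /peq[n cr cq]]]; exists n.+1.
    by apply/(has_cardS _ sj); apply: has_card_ext cr => x; rewrite rP.
  by apply/(has_cardS _ ti); apply: has_card_ext cq => x; rewrite qP.
have card_ex s : exists n, has_card (mem p s) n.
  by apply: (@has_card_bounded _ b) => j; exact: pb.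
have pall (B : nat -> Prop) : (forall j, B j -> exists s, mem p s j) ->
    exists s, forall j, mem p s j <-> B j.
  move=> BP.
  have [|n [l [_ _ lP]]] := @has_card_bounded B b.
    by move=> j /BP[s]; exact: pb.
  suff [s sP] : exists s, forall j, mem p s j <-> j \in l.
    by exists s => j; rewrite lP sP.
  have {}lP : forall j, j \in l -> exists s, mem p s j by move=> j /lP/BP.
  elim: l lP => [_|x l IH lP]; first by exists s0 => j; split=> // /s0P.
  have [j jl|s sP] := IH; first by apply: lP; rewrite inE jl orbT.
  have [|t tx] := lP x; first by rewrite inE eqxx.
  have [u uP] := pins s t x tx; exists u => j; rewrite uP sP inE.
  by split=> [[->|->]|/orP[/eqP|]]; rewrite ?orbT ?eqxx //; tauto.
split; [by exists b|exact: pall|].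
move=> s t; have [n] := card_ex s; elim: n s t => [|n IH] s t cs.
  rewrite peq; split.
    case=> [[_ /has_card0 t0]|]; first by exists 0.
    by case=> j [r] [i] [q] [[sj _] _]; move/has_card0: cs => /(_ j).
  case=> n' cs' ct; have n0 := has_card_inj cs cs'; subst n'.
  by left; split; exact/has_card0.
rewrite peq; split.
  case=> [[/has_card0 s0' _]|]; first by have := has_card_inj cs s0'.
  case=> j [r] [i] [q] [[sj rP] [[ti qP] erq]]; exists n.+1 => //.
  have cr : has_card (mem p r) n.
    by move/(has_cardS _ sj): cs; apply: has_card_ext => x; rewrite rP.
  have /IH := cr => /(_ q)[/(_ erq)[n' cr' cq] _].
  have nn := has_card_inj cr cr'; subst n'.
  by apply/(has_cardS _ ti); apply: has_card_ext cq => x; rewrite qP.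
case=> n' cs' ct; have nn := has_card_inj cs cs'; subst n'; right.
have [j sj] := has_card_nonempty cs; have [i ti] := has_card_nonempty ct.
have [x [sx _]|r rP] := pall (fun x => mem p s x /\ x <> j); first by exists s.
have [x [sx _]|q qP] := pall (fun x => mem p t x /\ x <> i); first by exists t.
have cr : has_card (mem p r) n.
  by move/(has_cardS _ sj): cs; apply: has_card_ext => x; rewrite rP.
exists j, r, i, q; split; first by split.
split; first by split.
apply/(IH _ _ cr); exists n => //.
by move/(has_cardS _ ti): ct; apply: has_card_ext => x; rewrite qP.
Qed.

Definition issucc p s t : Prop := exists r j, removal p r t j /\ eqc p s r.

Definition smaller p s t : Prop :=
  (forall j, mem p s j -> mem p t j) /\ exists j, mem p t j /\ ~ mem p s j.

(** The pair [P], [S] encodes a finite sequence of numbers: its term number [i]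
is the number of elements of [S] lying between the element number [i] of [P] and
the next one.  Here [i] and [x] are codes of sets, standing for their
cardinalities. *)
Definition seqat p P S i x : Prop :=
  exists j, mem p P j /\
    ((exists u, (forall z, mem p u z <-> mem p P z /\ z < j) /\ eqc p i u) /\
    exists u, (forall z, mem p u z <->
       mem p S z /\ (j < z /\ forall j', mem p P j' -> j < j' -> z < j')) /\ eqc p x u).

(** The clauses of [computes] with numbers replaced by codes of sets of that
cardinality, and the sequence of values of a primitive recursion by a pair of
sets as in [seqat].  Every witness must fit into the coded finite set, so a true
computation is represented only when this set is large enough. *)
Fixpoint represents (p : 'I_m -> nat) (n : nat) (f : recfun n) :
    ('I_n -> nat) -> nat -> Prop :=
  match f in recfun n return ('I_n -> nat) -> nat -> Prop with
  | RZero _ => fun _ y => isempty p y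
  | RSucc => fun s y => issucc p (s ord0) y
  | RProj _ i => fun s y => eqc p (s i) y
  | RComp _ _ g h => fun s y =>
      exists w, (forall i, represents p (h i) s (w i)) /\ represents p g w y
  | RPrec n g h => fun s y =>
      exists P S,
        (exists z x, isempty p z /\ (seqat p P S z x /\
           represents p g (fun i => s (lift ord0 i)) x)) /\
        ((forall i, smaller p i (s ord0) -> exists i' x x', issucc p i i' /\
           (seqat p P S i x /\ (seqat p P S i' x' /\
           represents p h (cons_vec i (cons_vec x (fun i => s (lift ord0 i)))) x'))) /\
        seqat p P S (s ord0) y)
  | RMin _ g => fun s y =>
      (exists z, isempty p z /\ represents p g (cons_vec y s) z) /\
      forall z, smaller p z y -> exists w, ~ isempty p w /\ represents p g (cons_vec z s) w
  end.

(** * Recursive functions represented by cardinalities *)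

Section SetCoding.
Variables (p : 'I_m -> nat) (gp : set_coding p).

Lemma card_ex s : exists n, has_card (mem p s) n.
Proof. by have [[b pb] _ _] := gp; apply: (@has_card_bounded _ b) => j; exact: pb. Qed.

Lemma eqc_cardP s t n : has_card (mem p s) n -> eqc p s t <-> has_card (mem p t) n.
Proof.
have [_ _ peq] := gp; move=> cs; rewrite peq; split=> [[n' cs' ct]|ct].
  by rewrite (has_card_inj cs cs').
by exists n.
Qed.

Lemma all_coded (B : nat -> Prop) s : (forall j, B j -> mem p s j) ->
  exists t, forall j, mem p t j <-> B j.
Proof. by have [_ pall _] := gp; move=> Bs; apply: pall => j /Bs; exists s. Qed.

Lemma issuccP s t n : has_card (mem p s) n -> issucc p s t <-> has_card (mem p t) n.+1.
Proof.
move=> cs; split=> [[r [j [[tj rP] /(eqc_cardP _ cs) cr]]]|ct].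
  by apply/(has_cardS _ tj); apply: has_card_ext cr => x; rewrite rP.
have [j tj] := has_card_nonempty ct.
have [x [sx _]//|r rP] := @all_coded (fun x => mem p t x /\ x <> j) t.
exists r, j; split; first by split.
apply/(eqc_cardP _ cs); move/(has_cardS _ tj): ct.
by apply: has_card_ext => x; rewrite rP.
Qed.

Lemma smaller_lt s t n k : has_card (mem p s) n -> has_card (mem p t) k ->
  smaller p s t -> n < k.
Proof. by move=> cs ct [st [j [tj nsj]]]; apply: (has_card_lt st tj nsj). Qed.

Lemma lt_smaller t n k : has_card (mem p t) k -> n < k ->
  exists2 s, has_card (mem p s) n & smaller p s t.
Proof.
move=> ct nk; have [B [Bt cB]] := has_card_sub ct (ltnW nk).
have [s sP] := all_coded Bt; exists s.
  by apply: has_card_ext cB => j; rewrite sP.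
split=> [j /sP/Bt//|]; apply: contrapT => no.
have : k <= n.
  apply: has_card_le ct cB => j tj; apply: contrapT => nB; apply: no.
  by exists j; rewrite sP.
by rewrite leqNgt nk.
Qed.

Let cards n (s : 'I_n -> nat) (v : n.-tuple nat) : Prop :=
  forall i, has_card (mem p (s i)) (tnth v i).

Lemma cards_cons n (s : 'I_n -> nat) v y ny :
  has_card (mem p y) ny -> cards s v -> cards (cons_vec y s) [tuple of ny :: v].
Proof.
move=> cy cs j; case: (unliftP ord0 j) => [i ->|->]; last by rewrite cons_vec0.
by rewrite cons_vecS tnthS.
Qed.

Lemma cards_behead n (s : 'I_n.+1 -> nat) v :
  cards s v -> cards (fun i => s (lift ord0 i)) (behead_tuple v).
Proof.
move=> cs i; rewrite tnth_behead; have := cs (lift ord0 i).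
by congr has_card; congr tnth; apply: val_inj; rewrite /= inordK // ltnS.
Qed.

(** The position in [P] is determined by the number of smaller elements of [P]. *)
Lemma seqat_functional P S : exists r : nat -> nat, forall i x ni nx,
  seqat p P S i x -> has_card (mem p i) ni -> has_card (mem p x) nx -> nx = r ni.
Proof.
suff /choice[r rP] : forall ni, exists n, forall i x nx, seqat p P S i x ->
    has_card (mem p i) ni -> has_card (mem p x) nx -> nx = n.
  by exists r => i x ni nx sx ci cx; exact: (rP ni i x).
move=> ni; apply: contrapT => /forallNP no.
have [i1 [x1 [n1 [s1 ci1 cx1 _]]]] : exists i x n, [/\ seqat p P S i x,
    has_card (mem p i) ni, has_card (mem p x) n & n <> 0].
  apply: contrapT => no'; apply: (no 0) => i x n sx ci cx.
  by apply: contrapT => n0; apply: no'; exists i, x, n.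
apply: (no n1) => i2 x2 n2 s2 ci2 cx2.
case: s1 => j1 [P1 [[u1 [u1P /(eqc_cardP _ ci1) cu1]] [v1 [v1P /(eqc_cardP _ cx1) cv1]]]].
case: s2 => j2 [P2 [[u2 [u2P /(eqc_cardP _ ci2) cu2]] [v2 [v2P /(eqc_cardP _ cx2) cv2]]]].
have jj : j1 = j2.
  have aux j j' u u' : mem p P j -> j < j' ->
      (forall z, mem p u z <-> mem p P z /\ z < j) ->
      (forall z, mem p u' z <-> mem p P z /\ z < j') ->
      has_card (mem p u) ni -> has_card (mem p u') ni -> False.
    move=> Pj jj' uP uP' cu cu'.
    suff : ni < ni by rewrite ltnn.
    apply: (has_card_lt (y := j) _ _ _ cu cu').
    + by move=> z /uP[Pz zj]; apply/uP'; split=> //; exact: ltn_trans jj'.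
    + exact/uP'.
    + by move=> /uP[_]; rewrite ltnn.
  case: (ltngtP j1 j2) => // lt; exfalso.
    exact: (aux j1 j2 u1 u2).
  exact: (aux j2 j1 u2 u1).
subst j2; apply: has_card_inj cv2 _.
by apply: has_card_ext cv1 => z; rewrite v1P v2P.
Qed.

(** The sequence read off [P] and [S] is a correct course of values, because
each number below a cardinality is the cardinality of a smaller subset. *)
Lemma represents_sound n (f : recfun n) (s : 'I_n -> nat) y (v : n.-tuple nat) ny :
  represents p f s y -> (forall i, has_card (mem p (s i)) (tnth v i)) ->
  has_card (mem p y) ny -> computes f v ny.
Proof.
elim: f s y v ny => [{}n||{}n i|{}n k g IHg h IHh|{}n g IHg h IHh|{}n g IHg] s y v ny /=.
- by move=> /has_card0 y0 _ cy; exact: has_card_inj cy y0.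
- by move=> + cs cy => /(issuccP _ (cs ord0)); exact: has_card_inj.
- by move=> + cs cy => /(eqc_cardP _ (cs i)); exact: has_card_inj.
- move=> [w [hw gw]] cs cy.
  have /choice[c cP] : forall i, exists n, has_card (mem p (w i)) n by move=> i; exact: card_ex.
  exists [tuple c i | i < k]; split=> [i|].
    by rewrite tnth_mktuple; apply: IHh (hw i) _ (cP i).
  by apply: IHg gw _ cy => i; rewrite tnth_mktuple.
- move=> [P [S [[z [x [z0 [Szx gx]]]] [step last]]]] cs cy.
  have [r rP] := seqat_functional P S.
  have cb := cards_behead cs.
  have cv : has_card (mem p (s ord0)) (thead v) by exact: cs.
  exists r; split.
  + have [nx cx] := card_ex x.
    rewrite -(rP _ _ _ _ Szx _ cx); last exact/has_card0.
    exact: IHg gx _ cx.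
  + move=> i iv; have [si csi /step] := lt_smaller cv iv.
    case=> i' [x1] [x2] [/(issuccP _ csi) ci' [S1 [S2 hx]]].
    have [n1 cx1] := card_ex x1; have [n2 cx2] := card_ex x2.
    rewrite -(rP _ _ _ _ S1 csi cx1) -(rP _ _ _ _ S2 ci' cx2).
    by apply: IHh hx _ cx2; apply: cards_cons => //; exact: cards_cons.
  + exact: rP last cv cy.
- move=> [[z [z0 gz]] below] cs cy; split.
    by apply: IHg gz (cards_cons cy cs) _; exact/has_card0.
  move=> i iy; have [si csi /below[w [w0 gw]]] := lt_smaller cy iy.
  have [[|nw] cw] := card_ex w; first by case: w0; exact/has_card0.
  by exists nw; apply: IHg gw (cards_cons csi cs) cw.
Qed.

Let total n : Prop := has_card (fun j => exists s, mem p s j) n.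

Lemma code_of_card N n : total N -> n <= N -> exists s, has_card (mem p s) n.
Proof.
move=> cN nN; have [_ pall _] := gp; have [B [BP cB]] := has_card_sub cN nN.
by have [s sP] := pall B BP; exists s; apply: has_card_ext cB => j; rewrite sP.
Qed.

(** List the coded numbers in increasing order and cut this list into consecutive
blocks of lengths [(r 0).+1], ..., [(r n).+1]: [P] collects the first element of
each block and [S] the others. *)
Lemma seqat_complete (r : nat -> nat) n N :
  total N -> \sum_(i < n.+1) (r i).+1 <= N ->
  exists P S, forall i x ni, ni <= n -> has_card (mem p i) ni ->
    has_card (mem p x) (r ni) -> seqat p P S i x.
Proof.
move=> [l [ul sl lP]] rN; have [_ pall _] := gp.
pose q := nth 0 (sort leq l).
have qlt a b : a < b -> b < N -> q a < q b.
  move=> ab bN; have srt : sorted ltn (sort leq l).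
    by rewrite ltn_sorted_uniq_leq sort_uniq ul sort_sorted //; exact: leq_total.
  by apply: (sorted_ltn_nth ltn_trans 0 srt); rewrite ?inE ?size_sort ?sl; lia.
have qP a : a < N -> exists s, mem p s (q a).
  by move=> aN; apply/lP; rewrite -(mem_sort leq) mem_nth // size_sort sl.
pose pos i := \sum_(l < i) (r l).+1.
have posS i : pos i.+1 = pos i + (r i).+1 by rewrite /pos big_ord_recr.
have poslt i j : i < j -> pos i + (r i).+1 <= pos j.
  elim: j => // j IH; rewrite ltnS posS leq_eqVlt => /orP[/eqP->//|/IH]; lia.
have posN i d : i <= n -> d <= r i -> pos i + d < N.
  move=> i_n dr; have := poslt i n.+1; rewrite /pos in rN * => /(_ _).
  by move: rN; rewrite -/(pos n.+1) -/(pos i); lia.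
have qinj a b : a < N -> b < N -> q a = q b -> a = b.
  by move=> aN bN; have [/qlt|/qlt|//] := ltngtP a b => /(_ _) ? ?; lia.
have qltE a b : a < N -> b < N -> (q a < q b) = (a < b).
  move=> aN bN; have [ab|ba|->] := ltngtP a b; last by rewrite ltnn.
    by rewrite qlt.
  by apply/negbTE; rewrite -leqNgt ltnW // qlt.
have posinj i j : pos i = pos j -> i = j.
  by move=> e; have [/poslt|/poslt|//] := ltngtP i j; lia.
have [_ [i i_n ->]|P PP] := pall (fun j => exists2 i, i <= n & j = q (pos i)).
  by apply: qP; have := posN i 0 i_n; lia.
have [_ [i [d [i_n dr ->]]]|S SP] := pall (fun j => exists i d,
    [/\ i <= n, d < r i & j = q (pos i + d.+1)]).
  by apply: qP; exact: posN.
exists P, S => i x ni nin ci cx; exists (q (pos ni)).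
have pos0N j : j <= n -> pos j < N by move=> jn; have := posN j 0 jn; lia.
split; first by apply/PP; exists ni.
split.
  have [z [/PP[j jn ->] _]|u uP] := pall (fun z => mem p P z /\ z < q (pos ni)).
    exact/qP/pos0N.
  exists u; split=> //; apply/(eqc_cardP _ ci).
  exists [seq q (pos j) | j <- iota 0 ni]; split.
  - rewrite map_inj_in_uniq ?iota_uniq // => a b.
    by rewrite !mem_iota => aN bN /qinj e; apply/posinj/e; apply: pos0N; lia.
  - by rewrite size_map size_iota.
  - move=> z; rewrite uP; split.
      case=> /PP[j jn ->]; rewrite qltE ?pos0N // => lt.
      apply/mapP; exists j => //; rewrite mem_iota /= add0n ltnNge; apply/negP.
      by rewrite leq_eqVlt => /orP[/eqP e|/poslt]; [rewrite e ltnn in lt|lia].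
    case/mapP => j; rewrite mem_iota /= add0n => jni ->.
    have jn : j <= n by lia.
    split; first by apply/PP; exists j.
    by rewrite qltE ?pos0N //; have := poslt _ _ jni; lia.
have [z [/SP[j [d [jn dr ->]]] _]|u uP] := pall (fun z => mem p S z /\
   (q (pos ni) < z /\ forall j', mem p P j' -> q (pos ni) < j' -> z < j')).
  exact/qP/posN.
exists u; split=> //; apply/(eqc_cardP _ cx).
exists [seq q (pos ni + d.+1) | d <- iota 0 (r ni)]; split.
- rewrite map_inj_in_uniq ?iota_uniq // => a b.
  rewrite !mem_iota /= !add0n => aN bN /qinj e.
  have : pos ni + a.+1 = pos ni + b.+1 by apply: e; exact: posN.
  lia.
- by rewrite size_map size_iota.
- move=> z; rewrite uP; split.
    case=> /SP[j [d [jn dr ->]]] [lt nx].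
    move: lt; rewrite qltE ?pos0N //; last exact: posN.
    move=> lt; have [jlt|nij|jni] := ltngtP j ni.
    + by have := poslt _ _ jlt; lia.
    + have := nx (q (pos j)); rewrite !qltE ?pos0N //; last exact: posN.
      have Pj : mem p P (q (pos j)) by apply/PP; exists j.
      by have := poslt _ _ nij => lt' /(_ Pj (leq_trans _ lt')); lia.
    + by apply/mapP; exists d; rewrite -?jni // mem_iota.
  case/mapP => d; rewrite mem_iota /= add0n => dr ->.
  split; first by apply/SP; exists ni, d.
  split; first by rewrite qltE ?pos0N ?posN //; lia.
  move=> _ /PP[j jn ->]; rewrite !qltE ?pos0N ?posN //.
  move=> lt; have [jlt|nij|jni] := ltngtP j ni.
  + by have := poslt _ _ jlt; lia.
  + by have := poslt _ _ nij; lia.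
  + by rewrite jni ltnn in lt.
Qed.

End SetCoding.

(** The bound [L] is a maximum over the finitely many values and calls of the
computation; it serves all codings at once, which is what lets the coding be
chosen after the computation. *)
Lemma represents_complete n (f : recfun n) (v : n.-tuple nat) ny : computes f v ny ->
  exists L, forall p, set_coding p -> forall N, L <= N ->
    has_card (fun j => exists s, mem p s j) N ->
    forall (s : 'I_n -> nat) y, (forall i, has_card (mem p (s i)) (tnth v i)) ->
    has_card (mem p y) ny -> represents p f s y.
Proof.
elim: f v ny => [{}n||{}n i|{}n k g IHg h IHh|{}n g IHg h IHh|{}n g IHg] v ny /=.
- move=> ->; exists 0 => p gp N _ _ s y _ y0; exact/has_card0.
- move=> ->; exists 0 => p gp N _ _ s y cs cy.
  exact/(issuccP gp _ (cs ord0)).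
- move=> ->; exists 0 => p gp N _ _ s y cs cy.
  exact/(eqc_cardP gp _ (cs i)).
- move=> [w [hw /IHg[Lg gP]]].
  have /choice[L LP] := fun i => IHh i v (tnth w i) (hw i).
  exists (Lg + \sum_i (L i + tnth w i)) => p gp N LN cN s y cs cy.
  have LiN i : L i + tnth w i <= N.
    apply: leq_trans LN; apply: leq_trans (leq_addl _ _).
    by rewrite (bigD1 i) //= leq_addr.
  have /choice[c cP] : forall i, exists c, has_card (mem p c) (tnth w i).
    by move=> i; apply: (code_of_card gp cN); have := LiN i; lia.
  exists c; split=> [i|].
    by apply: (LP i p gp N _ cN) => //; have := LiN i; lia.
  by apply: (gP p gp N _ cN) => //; lia.
- move=> [r [/IHg[Lg gP] hr ->]].
  have /choice[L LP] : forall i, exists L, i < thead v -> forall p, set_coding p ->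
      forall N, L <= N -> has_card (fun j => exists s, mem p s j) N ->
      forall s y, (forall j, has_card (mem p (s j))
         (tnth [tuple of i :: r i :: behead_tuple v] j)) ->
      has_card (mem p y) (r i.+1) -> represents p h s y.
    move=> i; have [/hr/IHh[L LP]|] := ltnP i (thead v); first by exists L.
    by exists 0.
  exists (Lg + \sum_(i < thead v) L i + \sum_(i < (thead v).+1) (r i).+1) => p gp N LN cN s y cs cy.
  have LiN i : i < thead v -> L i <= N.
    move=> iv; apply: leq_trans LN.
    by rewrite (bigD1 (Ordinal iv)) //=; lia.
  have rN i : i <= thead v -> r i <= N.
    rewrite -ltnS => iv; apply: leq_trans LN.
    by rewrite [X in _ <= _ + X](bigD1 (Ordinal iv)) //=; lia.
  have vN : (thead v).+1 <= N.
    apply: leq_trans LN; apply: leq_trans (leq_addl _ _).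
    rewrite -[X in X <= _]card_ord -sum1_card; exact: leq_sum.
  have cv : has_card (mem p (s ord0)) (thead v) by exact: cs.
  have [|P [S PS]] := @seqat_complete p gp r (thead v) N cN; first by lia.
  have cb := cards_behead cs.
  exists P, S; split; [|split].
  + have [z cz] := code_of_card gp cN (leq0n N).
    have [x cx] := code_of_card gp cN (rN 0 (leq0n _)).
    exists z, x; split; first exact/has_card0.
    split; first exact: PS cz cx.
    by apply: (gP p gp N _ cN) => //; lia.
  + move=> i si; have [ni ci] := card_ex gp i.
    have niv := smaller_lt ci cv si.
    have [i' ci'] : exists i', has_card (mem p i') ni.+1.
      by apply: (code_of_card gp cN); lia.
    have [x cx] := code_of_card gp cN (rN ni (ltnW niv)).
    have [x' cx'] := code_of_card gp cN (rN ni.+1 niv).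
    exists i', x, x'; split; first exact/(issuccP gp _ ci).
    split; first by apply: PS cx => //; exact: ltnW.
    split; first exact: PS cx'.
    apply: (LP ni niv p gp N (LiN _ niv) cN) => //.
    by apply: cards_cons => //; exact: cards_cons.
  + exact: PS cv cy.
- move=> [/IHg[L0 L0P] below].
  have /choice[w wP] : forall z, exists w, z < ny -> computes g [tuple of z :: v] w.+1.
    by move=> z; have [/below[w]|] := ltnP z ny; [exists w|exists 0].
  have /choice[L LP] : forall z, exists L, z < ny -> forall p, set_coding p ->
      forall N, L <= N -> has_card (fun j => exists s, mem p s j) N ->
      forall s y, (forall j, has_card (mem p (s j)) (tnth [tuple of z :: v] j)) ->
      has_card (mem p y) (w z).+1 -> represents p g s y.
    by move=> z; have [/wP/IHg[L LP]|] := ltnP z ny; [exists L|exists 0].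
  exists (L0 + \sum_(z < ny) (L z + (w z).+1)) => p gp N LN cN s y cs cy.
  have LiN i : i < ny -> L i + (w i).+1 <= N.
    move=> iv; apply: leq_trans LN.
    by rewrite (bigD1 (Ordinal iv)) //=; lia.
  split.
    have [z cz] := code_of_card gp cN (leq0n N).
    exists z; split; first exact/has_card0.
    by apply: (L0P p gp N _ cN) => //; [lia|exact: cards_cons].
  move=> z sz; have [nz cz] := card_ex gp z; have nzy := smaller_lt cz cy sz.
  have LN' := LiN _ nzy.
  have [x cx] : exists x, has_card (mem p x) (w nz).+1.
    by apply: (code_of_card gp cN); lia.
  exists x; split; first by move/has_card0/(has_card_inj cx).
  by apply: (LP nz nzy p gp N _ cN) => //; [lia|exact: cards_cons].
Qed.

End Coding.

(** * Diagonalization *)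

Lemma computes_functional n (f : recfun n) v y z :
  computes f v y -> computes f v z -> y = z.
Proof.
elim: f v y z => [{}n||{}n i|{}n k g IHg h IHh|{}n g IHg h IHh|{}n g IHg] v y z /=.
- by move=> -> ->.
- by move=> -> ->.
- by move=> -> ->.
- move=> [w [hw gw]] [w' [hw' gw']]; apply: IHg gw _.
  suff -> : w = w' by [].
  by apply: eq_from_tnth => i; apply: IHh (hw i) (hw' i).
- move=> [r [r0 rS ->]] [r' [r0' rS' ->]].
  suff E i : i <= thead v -> r i = r' i by exact: E.
  elim: i => [_|i IH iv]; first exact: IHg r0 r0'.
  by apply: IHh (rS i iv) _; rewrite (IH (ltnW iv)); exact: rS'.
- move=> [gy by_] [gz bz]; have [yz|zy|//] := ltngtP y z.
    by have [w /(IHg _ _ _ gy)] := bz y yz.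
  by have [w /(IHg _ _ _ gz)] := by_ z zy.
Qed.

Lemma godel_inj k : injective (@godel k).
Proof.
have cinj : injective CodeSeq.code := can_inj CodeSeq.codeK.
elim=> [i j|i j|a y x|f IH|f IHf g IHg|f IH] [i' j'|i' j'|a' y' x'|f'|f' g'|f'] /cinj //.
- by case=> -> ->.
- by case=> -> ->.
- case=> /eqP; rewrite eqseq_cat ?size_tuple // => /andP[/eqP aa /eqP[-> ->]].
  by congr FTr; exact: val_inj.
- by case=> /IH->.
- by case=> /IHf-> /IHg->.
- by case=> /IH->.
Qed.

(** The equivalence also records that nothing else is computed. *)
Definition computable (phi : nat -> nat) : Prop :=
  exists f : recfun 1, forall x y, computes f [tuple x] y <-> y = phi x.

Lemma computable_ext phi psi : phi =1 psi -> computable phi -> computable psi.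
Proof. by move=> e [f fP]; exists f => x y; rewrite -e. Qed.

Lemma computable_id : computable id.
Proof. by exists (RProj ord0). Qed.

Lemma computable_succ : computable S.
Proof. by exists RSucc. Qed.

Lemma tuple1P (T : Type) (w : 1.-tuple T) : w = [tuple tnth w ord0].
Proof. by apply: eq_from_tnth => i; rewrite (ord1 i). Qed.

Lemma computable_comp phi psi :
  computable phi -> computable psi -> computable (phi \o psi).
Proof.
move=> [f fP] [g gP]; exists (RComp f (fun _ : 'I_1 => g)) => x y /=; split.
  move=> [w [/(_ ord0)/gP e]]; rewrite (tuple1P w) e.
  by move/fP.
move=> ->; exists [tuple psi x]; split=> [i|]; last exact/fP.
by rewrite (ord1 i); apply/gP.
Qed.

Lemma computable_const c : computable (fun=> c).
Proof.
elim: c => [|c IH]; first by exists (RZero 1).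
exact: computable_comp computable_succ IH.
Qed.

Lemma computable_iter phi a b : computable phi -> computable a -> computable b ->
  computable (fun x => iter (a x) phi (b x)).
Proof.
move=> [f fP] [A AP] [B BP].
(* the step receives the index, the previous value and the start; it uses the second *)
pose F := RPrec (RProj (ord0 : 'I_1)) (RComp f (fun _ : 'I_1 => RProj (inord 1 : 'I_3))).
have FP n x y : computes F [tuple n; x] y <-> y = iter n phi x.
  split=> /=.
    move=> [r [r0 rS ->]]; rewrite (_ : thead _ = n) // in rS *.
    have rE i : i <= n -> r i = iter i phi x.
      elim: i => [_|i IH ni]; first exact: r0.
      have [w [/(_ ord0) w0]] := rS i ni; rewrite (tuple1P w) w0 => /fP ->.
      by rewrite (tnth_nth 0) /= inordK //= IH // ltnW.
    exact: rE.
  move=> ->; exists (fun i => iter i phi x); split=> // i ni.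
  exists [tuple iter i phi x]; split; last exact/fP.
  by move=> j; rewrite (ord1 j) (tnth_nth 0) /= (tnth_nth 0) /= inordK.
exists (RComp F (fun i : 'I_2 => if i == ord0 then A else B)) => x y; split.
  move=> [w [wP]].
  have -> : w = [tuple tnth w ord0; tnth w ord_max].
    apply: eq_from_tnth => i; rewrite [RHS](tnth_nth 0) /=.
    by case: i => -[|[|//]] ilt /=; congr tnth; exact: val_inj.
  by have /AP-> := wP ord0; have /BP-> := wP ord_max; move/FP.
move=> ->; exists [tuple a x; b x]; split; last exact/FP.
move=> i; rewrite (tnth_nth 0) /=.
by case: i => -[|[|//]] ilt /=; [exact/AP|exact/BP].
Qed.

Lemma computable_double : computable double.
Proof.
have cS2 := computable_comp computable_succ computable_succ.
apply: computable_ext (computable_iter cS2 computable_id (computable_const 0)) => x.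
by elim: x => //= x ->; rewrite doubleS.
Qed.

(** [CodeSeq.code (n :: s)] is [2 ^ n * (CodeSeq.code s).*2.+1]. *)
Lemma computable_pow2M c phi : computable phi ->
  computable (fun x => 2 ^ c * (phi x).*2.+1).
Proof.
move=> cphi.
have cd := computable_comp computable_succ (computable_comp computable_double cphi).
apply: computable_ext (computable_iter computable_double (computable_const c) cd) => x /=.
by elim: c => [|c IH]; rewrite ?mul1n // iterS IH expnS -mul2n mulnA.
Qed.

Lemma computable_pow2 phi : computable phi -> computable (fun x => 2 ^ phi x).
Proof.
move=> cphi.
apply: computable_ext (computable_iter computable_double cphi (computable_const 1)) => x /=.
by elim: (phi x) => //= n ->; rewrite expnS mul2n.
Qed.

Lemma computable_code2 c phi : computable phi ->
  computable (fun x => CodeSeq.code [:: c; phi x]).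
Proof.
move=> /computable_pow2 /(computable_pow2M c) cphi.
by apply: computable_ext cphi => x /=; rewrite muln1.
Qed.

Lemma computable_code3 c d phi : computable phi ->
  computable (fun x => CodeSeq.code [:: c; d; phi x]).
Proof.
move=> /computable_pow2 /(computable_pow2M d) /(computable_pow2M c) cphi.
by apply: computable_ext cphi => x /=; rewrite muln1.
Qed.

Lemma computable_iterc n phi : computable phi -> computable (iter n phi).
Proof.
by move=> cphi; apply: computable_iter cphi (computable_const n) computable_id.
Qed.

Section Diagonal.
Variables (k : nat) (Tr : k.-tuple nat -> nat -> nat -> Prop).

Lemma godel_FExs q (f : formula k) :
  godel (FExs q f) = iter q (fun z => CodeSeq.code [:: 5; z]) (godel f).
Proof. by elim: q => //= q ->. Qed.

(** A number [n] is presented as the end of an [S]-chain of length [n] of tuples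
that starts in [Z].  The sentence [D psi n] says that [psi] holds at the end of
such a chain; its code is a recursive function [d] of [n] when [n] is the code of
[psi], since it arises by iterating the fixed operation [W].  If [f] decided the
theory, let [psi] express that [f] rejects [d n]; then [D psi n] for [n] the code
of [psi] is true exactly when [f] rejects it. *)
Lemma undecidable_of_chains (q : nat) (Z : ('I_q -> nat) -> Prop)
    (S : ('I_q -> nat) -> ('I_q -> nat) -> Prop) :
  defpred Tr q (fun e => Z (fun i => e i)) ->
  defpred Tr (q + q) (fun e => S (fun i => e i) (fun i => e (q + i))) ->
  (forall g : recfun 1, exists G : ('I_q -> nat) -> Prop,
     defpred Tr q (fun e => G (fun i => e i)) /\
     forall n, computes g [tuple n] 0 <->
       exists w : nat -> 'I_q -> nat,
         [/\ Z (w 0), forall i, i < n -> S (w i.+1) (w i) & G (w n)]) ->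
  ~ decidable_theory Tr.
Proof.
move=> [chi0 [fr0 s0]] [chi1 [fr1 s1]] rep_g [f fP].
pose W psi := FExs q (FAnd chi1 psi).
pose D psi n := FExs q (FAnd chi0 (iter n W psi)).
pose d x := iter q (fun z => CodeSeq.code [:: 5; z]) (CodeSeq.code [:: 4; godel chi0;
  iter x (fun z => iter q (fun z => CodeSeq.code [:: 5; z])
    (CodeSeq.code [:: 4; godel chi1; z])) x]).
have dE psi : d (godel psi) = godel (D psi (godel psi)).
  have E n : iter n (fun z => iter q (fun z => CodeSeq.code [:: 5; z])
      (CodeSeq.code [:: 4; godel chi1; z])) (godel psi) = godel (iter n W psi).
    elim: n => // n IH; rewrite iterS IH.
    exact: esym (godel_FExs q (FAnd chi1 (iter n W psi))).
  by rewrite /d E; exact: esym (godel_FExs q (FAnd chi0 (iter _ W psi))).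
have [F FP] : computable d.
  have c5 := computable_code2 5 computable_id.
  apply: (computable_comp (computable_iterc q c5)).
  apply: computable_code3; apply: computable_iter computable_id computable_id.
  apply: (computable_comp (computable_iterc q c5)).
  exact: computable_code3 computable_id.
pose g := RComp f (fun _ : 'I_1 => F).
have gP n y : computes g [tuple n] y <-> computes f [tuple d n] y.
  split=> /= [[w [/(_ ord0)/FP e]]|fd]; first by rewrite (tuple1P w) e.
  by exists [tuple d n]; split=> // i; rewrite (ord1 i); exact/FP.
have [G [[psi [frp sp]] GP]] := rep_g g.
have loE (w : 'I_q -> nat) e : (fun i : 'I_q => env_app w e i) = w.
  by apply/funext => i; rewrite env_app_lo.
have hiE (w : 'I_q -> nat) e : (fun i : 'I_q => env_app w e (q + i)) = (fun i : 'I_q => e i).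
  by apply/funext => i; rewrite env_app_hi.
have WP n w e : sat Tr (env_app w e) (iter n W psi) <-> exists c : nat -> 'I_q -> nat,
    [/\ c 0 = w, forall i, i < n -> S (c i.+1) (c i) & G (c n)].
  elim: n w e => [|n IH] w e.
    rewrite /= -sp loE; split=> [Gw|[c [<- _ //]]].
    by exists (fun=> w).
  rewrite iterS [W _]lock /= -lock /W sat_FExs; split.
    move=> [w' [/s1]]; rewrite loE hiE loE => Sw /IH[c [c0 cS cG]].
    exists (fun i => if i is j.+1 then c j else w); split=> // -[_|i]; first by rewrite c0.
    exact: cS.
  move=> [c [c0 cS cG]]; exists (c 1); split.
    by apply/s1; rewrite loE hiE loE -c0; exact: cS.
  by apply/IH; exists (fun i => c i.+1); split=> // i; exact: (cS i.+1).
have DP n e : sat Tr e (D psi n) <-> computes g [tuple n] 0.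
  rewrite GP sat_FExs /=; split.
    move=> [w [/s0 + /WP[c [c0 cS cG]]]]; rewrite loE => Zw.
    by exists c; rewrite c0.
  move=> [c [Zc cS cG]]; exists (c 0); split; first by apply/s0; rewrite loE.
  by apply/WP; exists c.
have sD n : sentence (D psi n).
  rewrite /sentence free_FExs addn0 /= fr0 /=.
  elim: n => //= n IH; rewrite free_FExs /= fr1 /=.
  by apply: free_below_le IH; exact: leq_addr.
set x := godel psi.
have [f1 f0] := fP (d x).
have dx : ([set godel phi | phi in [set phi : formula k |
    sentence phi /\ true_in Tr phi]] (d x))%classic <-> computes g [tuple x] 0.
  split=> [[phi [_ phiT]]|gx].
    by rewrite dE => /godel_inj e; apply/(DP x (fun=> 0)); rewrite -e; exact: phiT.
  by exists (D psi x); rewrite -?dE //; split=> // e; exact/DP.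
have [gx|ngx] := pselect (computes g [tuple x] 0).
  have fx1 : computes f [tuple d x] 1 by apply/f1/dx.
  by move/gP: gx => fx0; have := computes_functional fx0 fx1.
by apply: (ngx); apply/gP/f0 => /dx.
Qed.

(** From here on [mem] and [eqc] are first-order. *)

Section Represent.
Variables (m : nat) (mem eqc : ('I_m -> nat) -> nat -> nat -> Prop).
Hypothesis def_mem : forall n (p : 'I_m -> nat) s j, (forall i, p i < n) ->
  s < n -> j < n -> defpred Tr n (fun e => mem (fun i => e (p i)) (e s) (e j)).
Hypothesis def_eqc : forall n (p : 'I_m -> nat) s t, (forall i, p i < n) ->
  s < n -> t < n -> defpred Tr n (fun e => eqc (fun i => e (p i)) (e s) (e t)).

Ltac def_step :=
  first [apply: def_mem; def_bound | apply: def_eqc; def_bound | def_logic].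

Lemma def_isempty n (p : 'I_m -> nat) s : (forall i, p i < n) -> s < n ->
  defpred Tr n (fun e => isempty mem (fun i => e (p i)) (e s)).
Proof. by move=> pn sn; rewrite /isempty; repeat def_step. Qed.

Lemma def_set_coding n (p : 'I_m -> nat) : (forall i, p i < n) ->
  defpred Tr n (fun e => set_coding mem eqc (fun i => e (p i))).
Proof.
move=> pn; apply: def_ext (fun e => set_codingP mem eqc (fun i => e (p i))) _.
by rewrite /set_coding_fo /isempty /removal; repeat def_step.
Qed.

Lemma def_issucc n (p : 'I_m -> nat) s t : (forall i, p i < n) -> s < n -> t < n ->
  defpred Tr n (fun e => issucc mem eqc (fun i => e (p i)) (e s) (e t)).
Proof. by move=> pn sn tn; rewrite /issucc /removal; repeat def_step. Qed.

Lemma def_smaller n (p : 'I_m -> nat) s t : (forall i, p i < n) -> s < n -> t < n ->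
  defpred Tr n (fun e => smaller mem (fun i => e (p i)) (e s) (e t)).
Proof. by move=> pn sn tn; rewrite /smaller; repeat def_step. Qed.

Lemma def_seqat n (p : 'I_m -> nat) P S i x : (forall i, p i < n) ->
  P < n -> S < n -> i < n -> x < n ->
  defpred Tr n (fun e => seqat mem eqc (fun i => e (p i)) (e P) (e S) (e i) (e x)).
Proof. by move=> pn ? ? ? ?; rewrite /seqat; repeat def_step. Qed.

Lemma def_represents q (f : recfun q) n (p : 'I_m -> nat) (s : 'I_q -> nat) y :
  (forall i, p i < n) -> (forall i, s i < n) -> y < n ->
  defpred Tr n (fun e => represents mem eqc (fun i => e (p i)) f (fun i => e (s i)) (e y)).
Proof.
have consE n' (x : nat) (t : 'I_n' -> nat) (e : nat -> nat) :
    cons_vec (e x) (fun i => e (t i)) = (fun i => e (cons_vec x t i)).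
  by apply/funext => i; rewrite (cons_vec_comp e).
have cons_lt n' N (x : nat) (t : 'I_n' -> nat) : x < N -> (forall i, t i < N) ->
    forall i, cons_vec x t i < N.
  by move=> xN tN i; case: (unliftP ord0 i) => [j ->|->]; rewrite ?cons_vecS ?cons_vec0.
elim: f n p s y => [{}q||{}q i|{}q k' g IHg h IHh|{}q g IHg h IHh|{}q g IHg] n p s y pn sn yn /=.
- exact: def_isempty.
- exact: def_issucc.
- exact: def_eqc.
- apply: def_exv; apply: def_and.
    apply: def_all_ord => i.
    apply: (IHh i _ (fun i => k' + p i) (fun i => k' + s i)) => *; rewrite ?ltn_add2l //.
    by apply: ltn_addr.
  apply: (IHg _ (fun i => k' + p i) (fun i => i : nat)) => *; rewrite ?ltn_add2l //.
  by apply: ltn_addr.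
- apply: def_ex; apply: def_ex; apply: def_and; [|apply: def_and].
  + apply: def_ex; apply: def_ex; apply: def_and; [|apply: def_and].
    * by apply: def_isempty.
    * by apply: def_seqat => //.
    * apply: (IHg _ (fun i => (p i).+4) (fun i => (s (lift ord0 i)).+4) 0) => // i.
      exact: sn.
  + apply: def_all; apply: def_imp; first by apply: def_smaller => //=; rewrite ?ltnS.
    do 3 apply: def_ex.
    apply: def_and; [|apply: def_and; [|apply: def_and]].
    * by apply: def_issucc.
    * by apply: def_seqat.
    * by apply: def_seqat.
    * apply: def_ext; first move=> e.
        rewrite (consE _ 1 (fun i => (s (lift ord0 i)).+4.+2) e) (consE _ 3 _ e).
        exact: iff_refl.
      apply: (IHh _ (fun i => (p i).+4.+2)
        (cons_vec 3 (cons_vec 1 (fun i => (s (lift ord0 i)).+4.+2))) 0) => //.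
      by apply: (cons_lt) => //; apply: cons_lt => // i; exact: sn.
  + by apply: def_seqat => //; exact: sn.
- apply: def_and.
    apply: def_ex; apply: def_and; first exact: def_isempty.
    apply: def_ext; first move=> e.
      rewrite (consE _ y.+1 (fun i => (s i).+1) e); exact: iff_refl.
    apply: (IHg _ (fun i => (p i).+1) (cons_vec y.+1 (fun i => (s i).+1)) 0) => //.
    exact: cons_lt.
  apply: def_all; apply: def_imp; first exact: def_smaller.
  apply: def_ex; apply: def_and; first by apply: def_not; exact: def_isempty.
  apply: def_ext; first move=> e.
    rewrite (consE _ 1 (fun i => (s i).+2) e); exact: iff_refl.
  apply: (IHg _ (fun i => (p i).+2) (cons_vec 1 (fun i => (s i).+2)) 0) => //.
  exact: cons_lt.
Qed.

(** The tuples of the chains consist of the parameters of a coding, constant along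
the chain, and of a code of a set whose cardinality grows by one at each step.
The parameters are repeated at each step so that the formula at the end of the
chain has a fixed number of free variables. *)
Lemma undecidable_of_coding :
  (forall L, exists p, set_coding mem eqc p /\
     exists2 N, L <= N & has_card (fun j => exists s, mem p s j) N) ->
  ~ decidable_theory Tr.
Proof.
move=> coding.
pose par (w : 'I_m.+1 -> nat) : 'I_m -> nat := fun i => w (lift ord0 i).
apply: (@undecidable_of_chains m.+1
  (fun w => set_coding mem eqc (par w) /\ isempty mem (par w) (w ord0))
  (fun w' w => (forall i, w' (lift ord0 i) = w (lift ord0 i)) /\
               issucc mem eqc (par w) (w ord0) (w' ord0))).
- by apply: def_and; [apply: def_set_coding|apply: def_isempty] => // i; exact: ltn_ord.
- apply: def_and.
    apply: def_all_ord => i; apply: def_eq; have := ltn_ord i; rewrite /= /bump /=; lia.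
  apply: def_issucc => [i||] /=; try lia.
  by have := ltn_ord i; rewrite /= /bump /=; lia.
move=> g; exists (fun w => exists z, isempty mem (par w) z /\
    represents mem eqc (par w) g (fun=> w ord0) z); split.
  apply: def_ex; apply: def_and.
    by apply: def_isempty => // i; rewrite ltnS; exact: ltn_ord.
  apply: (def_represents g (p := fun i => (lift ord0 i : nat).+1) (s := fun=> 1)) => // i.
  by rewrite ltnS; exact: ltn_ord.
move=> n; split.
  move=> cg; have [L LP] := @represents_complete m mem eqc _ _ _ _ cg.
  have [p [gp [N LN cN]]] := coding (maxn L n).
  have /choice[c cP] : forall i, exists s, i <= n -> has_card (mem p s) i.
    move=> i; have [iN|] := leqP i n; last by exists 0.
    have [|s cs] := code_of_card gp cN (_ : i <= N); first by lia.
    by exists s.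
  have parE i : par (cons_vec (c i) p) = p by apply/funext => j; exact: cons_vecS.
  exists (fun i => cons_vec (c i) p); rewrite parE cons_vec0; split.
  - by split=> //; apply/has_card0/cP.
  - move=> i ilt; rewrite parE !cons_vec0; split=> [j|]; first by rewrite !cons_vecS.
    by apply/(issuccP gp _ (cP _ (ltnW ilt)))/cP.
  - rewrite parE cons_vec0; have [z cz] := code_of_card gp cN (leq0n N).
    exists z; split; first exact/has_card0.
    apply: (LP p gp N _ cN) => //; first by lia.
    by move=> i; rewrite (ord1 i); exact: cP.
move=> [w [[gp w0] wS [z [z0 rz]]]].
have parE i : i <= n -> par (w i) = par (w 0).
  by elim: i => // i IH ilt; rewrite -IH 1?ltnW //; apply/funext => j; exact: (wS i ilt).1.
have wc i : i <= n -> has_card (mem (par (w 0)) (w i ord0)) i.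
  elim: i => [_|i IH ilt]; first exact/has_card0.
  have [_] := wS i ilt; rewrite parE 1?ltnW //.
  by move/(issuccP gp _ (IH (ltnW ilt))).
rewrite parE // in rz z0.
apply: (represents_sound gp rz) => [i|]; last exact/has_card0.
by rewrite (ord1 i); exact: wc.
Qed.

End Represent.
End Diagonal.

(** * Sparse sequences and the jumps of a node *)

Lemma fat_le F m n t : is_tree F -> m <= n -> fat F n t -> fat F m t.
Proof.
move=> treeF; elim: n => [|n IH]; first by rewrite leqn0 => /eqP->.
by rewrite leq_eqVlt => /orP[/eqP->//|/IH{}IH /(fatS treeF)].
Qed.

(** For the passage from [u] to [v]: if large jumps from [t] to sets fat of order
[n] exist at all, one of them falls between [u] and [v]; otherwise none passes
over [v]. *)
Definition decides_jumps (F : set (set nat)) (u v n : nat) (t : set nat) : Prop :=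
  (fat F n.+1 t -> exists2 s, jump u t s /\ (forall x, s x -> x < v) & fat F n s) /\
  (~ fat F n.+1 t -> forall s, jump v t s -> ~ fat F n s).

Lemma decides_jumps_le F u v v' n t :
  v <= v' -> decides_jumps F u v n t -> decides_jumps F u v' n t.
Proof.
move=> vv' [h1 h2]; split=> [/h1[s [js sv] fs]|/h2 h s js].
  by exists s => //; split=> // x /sv; lia.
by apply: h; exact: jump_le js.
Qed.

Lemma decides_jumps_ex F u n t : is_tree F -> exists v, decides_jumps F u v n t.
Proof.
move=> treeF; have [ft|nft] := pselect (fat F n.+1 t).
  have [s js fs] := ft u; have [v sv] := node_bound treeF (fat_node treeF fs).
  by exists v; split=> // _; exists s.
have /existsNP[v vP] := nft.
by exists v; split=> // _ s js fs; apply: vP; exists s.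
Qed.

Section Sparse.
Variables (F : set (set nat)) (w : nat -> nat) (N : nat).
Hypothesis wS : forall j, w j < w j.+1.
Hypothesis wP : forall j n t, n <= N -> (forall x, t x -> x < w j) ->
  decides_jumps F (w j) (w j.+1) n t.

Lemma sparse_le a b : a <= b -> w a <= w b.
Proof.
elim: b => [|b IH]; first by rewrite leqn0 => /eqP->.
rewrite leq_eqVlt => /orP[/eqP->//|/IH]; have := wS b; lia.
Qed.

(** From a fat node a path can be built by jumps alone, each landing between
consecutive terms of [w], at freely prescribed places. *)
Lemma sparse_path l j0 t : sorted ltn l -> all (leq j0) l -> size l <= N ->
  (forall x, t x -> x < w j0) -> fat F (size l) t ->
  exists u, [/\ F u, initial_segment t u,
    forall x, u x -> t x \/ exists2 j, j \in l & w j < x < w j.+1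
    & forall j, j \in l -> exists2 x, u x & w j < x < w j.+1].
Proof.
elim: l j0 t => [|j l IH] j0 t.
  move=> _ _ _ _ Ft; exists t; split=> //; first exact: initial_segment_refl.
  by move=> x tx; left.
move=> srt /= /andP[j0j j0l] lN tj0 ft.
have jl : all (leq j.+1) l by exact: (order_path_min ltn_trans srt).
have tj x : t x -> x < w j by move=> /tj0; have := sparse_le j0j; lia.
have [/(_ ft)[s [js sv] fs] _] := wP (ltnW lN) tj.
have [u [Fu su uP lP]] := IH j.+1 s (path_sorted srt) jl (ltnW lN) sv fs.
have [ts [y sy nty] jmp] := js.
exists u; split=> //.
- exact: initial_segment_trans su.
- move=> x /uP[sx|[i il xi]]; last by right; exists i => //; rewrite inE il orbT.
  have [tx|ntx] := pselect (t x); [by left|right].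
  by exists j; [rewrite inE eqxx|rewrite jmp // sv].
- move=> i; rewrite inE => /orP[/eqP->|/lP//].
  by exists y; [exact: su.1|rewrite jmp // sv].
Qed.

(** Conversely every jump of a path [u] over an interval of [w] lowers the rank:
the part of [u] before the interval has rank at most [size l], hence is not fat of
order [(size l).+1] for the tail [l], and [decides_jumps] excludes that the part
after the interval has rank at least [size l].  The witnesses beyond the
intervals separate consecutive jumps. *)
Lemma sparse_drop l t u : sorted ltn l -> size l <= N -> F u ->
  initial_segment t u -> ~ rank_ge F (size l) t ->
  (forall j x, j \in l -> t x -> x < w j) ->
  (forall j x, j \in l -> u x -> x < w j \/ w j.+1 < x) ->
  (forall j, j \in l -> exists2 x, u x &
     w j.+1 < x /\ forall i, i \in l -> j < i -> x < w i) ->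
  False.
Proof.
elim: l t => [|j l IH] t; first by move=> _ _ Fu tu nr _ _ _; apply: nr; exists u.
move=> srt lN Fu tu /= nr tl ul lx.
have jin : j \in j :: l by rewrite mem_head.
have lin i : i \in l -> i \in j :: l by move=> il; rewrite inE il orbT.
have jlt i : i \in l -> j < i.
  by move=> il; exact: (allP (order_path_min ltn_trans srt)).
pose t1 := cut (w j) u.
have tt1 : initial_segment t t1 by apply: initial_segment_cut => // x; exact: tl.
have nf1 : ~ fat F (size l).+1 t1 by move=> f1; apply: nr; exists t1.
have t1w x : t1 x -> x < w j by case.
have [_ /(_ nf1) nj] := wP (ltnW lN) t1w.
have [x ux [wx xi]] := lx j jin.
pose t2 := cut x.+1 u.
have jmp2 : jump (w j.+1) t1 t2.
  have wj := wS j; split.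
  - apply: initial_segment_cut; first exact: cut_initial_segment.
    by move=> y [_ yw]; lia.
  - by exists x; [split|move=> [_]; lia].
  - move=> y [uy _] nt1y; case: (ul j y jin uy) => // yw.
    by case: nt1y; split.
apply: (IH t2) => //.
- exact: path_sorted srt.
- exact: ltnW.
- exact: cut_initial_segment.
- by move=> [v t2v fv]; apply: (nj v) => //; exact: jump_ext t2v.
- by move=> i y il [_ yx]; have := xi i (lin i il) (jlt i il); lia.
- by move=> i y /lin il; exact: ul.
- move=> i il; have [y uy [wy yi]] := lx i (lin i il).
  by exists y => //; split=> // i' /lin; exact: yi.
Qed.
End Sparse.

(** Below a given number there are only finitely many orders, parameters and sets,
so one bound serves all of them. *)
Lemma sparse_scale k (Tr : k.-tuple nat -> nat -> nat -> Prop) :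
  defines_family_of_trees Tr -> exists g : nat -> nat, forall u, u < g u /\
    forall a n t, (forall i, tnth a i <= u) -> n <= u -> (forall x, t x -> x < u) ->
      decides_jumps (tree_of Tr a) u (g u) n t.
Proof.
move=> hTr; suff /choice[g gP] : forall u, exists v, u < v /\
    forall a n t, (forall i, tnth a i <= u) -> n <= u -> (forall x, t x -> x < u) ->
      decides_jumps (tree_of Tr a) u v n t by exists g.
move=> u.
pose T := (k.-tuple 'I_u.+1 * 'I_u.+1 * {set 'I_u})%type.
pose P (x : T) v := decides_jumps (tree_of Tr [tuple tnth x.1.1 i : nat | i < k]) u v
   x.1.2 [set y | exists2 i : 'I_u, i = y :> nat & i \in x.2].
have [x b c|x|v vP] := @fin_collection T P.
- exact: decides_jumps_le.
- exact/decides_jumps_ex/hTr.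
exists (maxn v u.+1); split; first by lia.
move=> a n t au nu tu; apply: (@decides_jumps_le _ _ v); first by lia.
have := vP ([tuple inord (tnth a i) | i < k], inord n, [set i : 'I_u | `[< t i >]]%SET).
rewrite /P /= inordK ?ltnS //; congr decides_jumps.
  congr tree_of; apply: eq_from_tnth => i.
  by rewrite tnth_mktuple tnth_mktuple inordK // ltnS.
apply/seteqP; split=> y /=.
  by case=> i <-; rewrite inE => /asboolP.
move=> ty; exists (Ordinal (tu y ty)) => //.
by rewrite inE; exact/asboolP.
Qed.

(** * Coding finite sets by nodes of given rank *)

(** Two interlaced paths [sigma] and [theta] of the same tree mark the places on
a sparse sequence.  Blocks of a path cannot be controlled element by element, but
an element of [sigma] that is preceded by an element of [theta], with nothing
from [sigma] in between, is the first of its block. *)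

Section Points.
Variables sigma theta : set nat.

Definition line_point (y : nat) : Prop :=
  sigma y /\ exists z, theta z /\ (z < y /\ forall x, ~ (x < z) -> x < y -> ~ sigma x).

(** The numbers that lie beyond the next block of [theta] but before the next
point. *)
Definition zone (y x : nat) : Prop :=
  y < x /\ ((exists z, theta z /\ (y < z /\ z < x)) /\
            forall y', line_point y' -> y < y' -> x < y').

Definition marked (s : set nat) (y : nat) : Prop :=
  line_point y /\ exists x, s x /\ zone y x.

(** [u] meets the zone of [y] and contains nothing between [y] and the next block
of [theta]: it has jumped over the interval in front of that zone. *)
Definition jumps_over (u : set nat) (y : nat) : Prop :=
  (exists x, u x /\ zone y x) /\
  forall x, u x -> ~ (x < y) -> exists z, theta z /\ (y < z /\ z < x).

End Points.

(** The places on the sparse sequence [w], with period 4: the block number [j] of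
[sigma] lies above [w (4 * j)], that of [theta] above [w (4 * j + 2)], and the
interval above [w (4 * j + 3)] is left to the paths that mark the point number
[j], which is the first element of the block of [sigma].  The block number 0 has
no block of [theta] in front of it, so the points are numbered from 1. *)

Section Configuration.
Variables (w : nat -> nat) (L : nat).
Hypothesis wS : forall j, w j < w j.+1.
Variables (t sigma theta : set nat) (yk : nat -> nat).
Hypothesis t_lt : forall x, t x -> x < w 0.
Hypothesis sigma_t : forall x, t x -> sigma x.
Hypothesis sigmaP : forall x, sigma x ->
  t x \/ exists2 j, j <= L & w (4 * j) < x < w (4 * j + 1).
Hypothesis thetaP : forall x, theta x ->
  t x \/ exists2 j, j <= L & w (4 * j + 2) < x < w (4 * j + 3).
Hypothesis theta_ex : forall j, j <= L ->
  exists2 x, theta x & w (4 * j + 2) < x < w (4 * j + 3).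
Hypothesis ykP : forall j, j <= L ->
  [/\ sigma (yk j), w (4 * j) < yk j < w (4 * j + 1)
    & forall x, sigma x -> w (4 * j) < x -> yk j <= x].

Let wle a b : a <= b -> w a <= w b.
Proof. exact: sparse_le. Qed.

Lemma pointE y : line_point sigma theta y <-> exists2 j, 0 < j <= L & y = yk j.
Proof.
split.
  move=> [sy [z [tz [zy gap]]]].
  have nsz : ~ sigma z by apply: gap => //; rewrite ltnn.
  case: (thetaP tz) => [/sigma_t//|[i iL zi]].
  have := wle (leq0n (4 * i + 2)).
  case: (sigmaP sy) => [/t_lt|[j jL yj]]; first by lia.
  have ij : i < j.
    rewrite ltnNge; apply/negP => ji.
    by have := @wle (4 * j + 1) (4 * i + 2); lia.
  move=> _; exists j; first by lia.
  have [sj wj ymin] := ykP jL; have yjy := ymin y sy; apply/eqP.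
  rewrite eqn_leq yjy ?andbT; last by lia.
  rewrite leqNgt; apply/negP => lt; apply: gap (yk j) _ lt sj.
  by have := @wle (4 * i + 3) (4 * j); lia.
move=> [j /andP[j0 jL] ->]; have [sj wj ymin] := ykP jL.
split=> //; have [|z tz zj] := @theta_ex j.-1; first by lia.
exists z; split=> //; split.
  by have := @wle (4 * j.-1 + 3) (4 * j); lia.
move=> x xz xy sx; case: (sigmaP sx) => [/t_lt|[i iL xi]].
  by have := wle (leq0n (4 * j.-1 + 2)); lia.
have [ij|ji|ij] := ltngtP i j.
- by have := @wle (4 * i + 1) (4 * j.-1 + 2); lia.
- by have := @wle (4 * j + 1) (4 * i); lia.
- by subst i; have := ymin x sx; lia.
Qed.

Lemma yk_lt i j : i < j -> j <= L -> yk i < yk j.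
Proof.
move=> ij jL; have [|_ wi _] := @ykP i; first by lia.
have [_ wj _] := ykP jL; have := @wle (4 * i + 1) (4 * j); lia.
Qed.

Lemma theta_after j z : j <= L -> theta z -> yk j < z -> w (4 * j + 2) < z.
Proof.
move=> jL /thetaP[/t_lt|[i iL zi]]; have [_ wj _] := ykP jL.
  by have := wle (leq0n (4 * j)); lia.
have [ij|ji] := ltnP i j; first by have := @wle (4 * i + 3) (4 * j); lia.
by have := @wle (4 * j + 2) (4 * i + 2); lia.
Qed.

Lemma theta_between j x : j <= L -> w (4 * j + 3) < x ->
  exists z, theta z /\ (yk j < z /\ z < x).
Proof.
move=> jL wx; have [z tz zj] := theta_ex jL; have [_ wj _] := ykP jL.
by exists z; split=> //; have := @wle (4 * j + 1) (4 * j + 2); lia.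
Qed.

Lemma zone_intro j x : j <= L -> w (4 * j + 3) < x < w (4 * j + 4) ->
  zone sigma theta (yk j) x.
Proof.
move=> jL wx; have [_ wj _] := ykP jL; split.
  by have := @wle (4 * j + 1) (4 * j + 3); lia.
split; first by apply: theta_between; lia.
move=> _ /pointE[i /andP[i0 iL] ->] lt.
have ji : j < i.
  rewrite ltnNge; apply/negP; rewrite leq_eqVlt => /orP[/eqP e|/yk_lt]; last by lia.
  by rewrite e ltnn in lt.
by have [_ wi _] := ykP iL; have := @wle (4 * j + 4) (4 * i); lia.
Qed.

Lemma zone_lo j x : j <= L -> zone sigma theta (yk j) x -> w (4 * j + 2) < x.
Proof. by move=> jL [_ [[z [tz [yz zx]]] _]]; have := theta_after jL tz yz; lia. Qed.

Lemma zone_hi j i x : j < i -> i <= L -> zone sigma theta (yk j) x -> x < w (4 * i + 1).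
Proof.
move=> ji iL [_ [_ nx]]; have [_ wi _] := ykP iL.
have := nx (yk i); have := yk_lt ji iL => lt /(_ _ lt).
have Pi : line_point sigma theta (yk i) by apply/pointE; exists i => //; lia.
by move=> /(_ Pi); lia.
Qed.

(** The description, given by [sparse_path], of a path [u] from [v] that jumps
exactly to the marking intervals of the points in [ks]. *)
Definition marker (ks : seq nat) (v u : set nat) : Prop :=
  (forall x, u x -> v x \/
     exists2 j, j \in [seq 4 * i + 3 | i <- ks] & w j < x < w j.+1) /\
  forall j, j \in [seq 4 * i + 3 | i <- ks] -> exists2 x, u x & w j < x < w j.+1.

Section Marker.
Variables (ks : seq nat) (v u : set nat).
Hypothesis ksL : forall j, j \in ks -> 0 < j <= L.
Hypothesis v_lt : forall x, v x -> x < w 0.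
Hypothesis uP : marker ks v u.

Let u_block x : u x -> w 0 <= x ->
  exists2 j, j \in ks & w (4 * j + 3) < x < w (4 * j + 4).
Proof.
move=> ux wx; case: (uP.1 x ux) => [/v_lt|[_ /mapP[j jks ->] xj]]; first by lia.
by exists j => //; rewrite (addnS _ 3).
Qed.

Let u_ex j : j \in ks -> exists2 x, u x & w (4 * j + 3) < x < w (4 * j + 4).
Proof. by move=> jks; rewrite (addnS _ 3); apply: uP.2; exact: map_f. Qed.

Lemma marker_jumps j : j \in ks -> jumps_over sigma theta u (yk j).
Proof.
move=> jks; have /andP[j0 jL] := ksL jks; have [_ wj _] := ykP jL; split.
  by have [x ux xj] := u_ex jks; exists x; split=> //; exact: zone_intro.
move=> x ux nx; have w0 := wle (leq0n (4 * j)).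
have [|i iks xi] := u_block ux; first by lia.
apply: theta_between => //.
have ji : j <= i.
  by rewrite leqNgt; apply/negP => ij; have := @wle (4 * i + 4) (4 * j); lia.
by have := @wle (4 * j + 3) (4 * i + 3); lia.
Qed.

Lemma marker_marked y : marked sigma theta u y <-> exists2 j, j \in ks & y = yk j.
Proof.
split=> [[/pointE[j /andP[j0 jL] ->] [x [ux zx]]]|[j jks ->]]; last first.
  have /andP[j0 jL] := ksL jks; split; first by apply/pointE; exists j => //; lia.
  by have [] := marker_jumps jks.
have lo := zone_lo jL zx; have w0 := wle (leq0n (4 * j + 2)).
have [|i iks xi] := u_block ux; first by lia.
exists j => //; have /andP[i0 iL] := ksL iks.
have [ij|ji|<-//] := ltngtP i j.
  by have := @wle (4 * i + 4) (4 * j + 2); lia.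
by have := zone_hi ji iL zx; have := @wle (4 * i + 1) (4 * i + 3); lia.
Qed.

End Marker.

Lemma sorted_scale ks c : sorted ltn ks -> sorted ltn [seq 4 * i + c | i <- ks].
Proof. by move=> srt; rewrite sorted_map; apply: sub_sorted srt => i j /=; lia. Qed.

(** The jumps over the intervals above [w (4 * j + 1)] are real: a path that jumps
over the point number [j] has no elements between this point and the block of
[theta] after it. *)
Lemma rank_drop (G : set (set nat)) N ks v u :
  (forall j n s, n <= N -> (forall x, s x -> x < w j) ->
     decides_jumps G (w j) (w j.+1) n s) ->
  sorted ltn ks -> size ks <= N -> (forall j, j \in ks -> 0 < j <= L) ->
  (forall x, v x -> x < w 0) -> G u -> initial_segment v u ->
  (forall j, j \in ks -> jumps_over sigma theta u (yk j)) ->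
  rank_ge G (size ks) v.
Proof.
move=> wP srt kN ksL v_lt Gu vu ju; apply: contrapT => nr.
apply: (@sparse_drop G w N wS wP [seq 4 * i + 1 | i <- ks] v u) => //.
- exact: sorted_scale.
- by rewrite size_map.
- by rewrite size_map.
- by move=> j x _ /v_lt; have := wle (leq0n j); lia.
- move=> _ x /mapP[j jks ->] ux; have /andP[j0 jL] := ksL j jks.
  have [_ wj _] := ykP jL; have [_ nx] := ju j jks.
  have [xy|yx] := ltnP x (yk j); first by left; lia.
  have [|z [tz [yz zx]]] := nx x ux; first by apply/negP; rewrite -leqNgt.
  by right; rewrite -addnS; have := theta_after jL tz yz; lia.
- move=> _ /mapP[j jks ->]; have /andP[j0 jL] := ksL j jks.
  have [[x [ux zx]] _] := ju j jks; exists x => //; split.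
    by rewrite -addnS; exact: zone_lo.
  move=> _ /mapP[i iks ->] ji; have /andP[i0 iL] := ksL i iks.
  by apply: zone_hi zx => //; lia.
Qed.

End Configuration.

(** * Undecidability when all finite ranks occur *)

Section Trees.
Variables (k : nat) (Tr : k.-tuple nat -> nat -> nat -> Prop).

Definition node_at (b : 'I_k -> nat) (i : nat) : set nat :=
  [set y | Tr [tuple b j | j < k] y i].

Definition tree_at (b : 'I_k -> nat) : set (set nat) := tree_of Tr [tuple b j | j < k].

Lemma tree_at_tnth a : tree_at (tnth a) = tree_of Tr a.
Proof.
by rewrite /tree_at; congr tree_of; apply: eq_from_tnth => i; rewrite tnth_mktuple.
Qed.

(** The parameters of the coding: the parameter of a tree, the indices in it of
the paths [sigma] and [theta], and a bound for the counters. *)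
Definition par_vec (p : 'I_(k + 3) -> nat) : 'I_k -> nat := fun i => p (lshift 3 i).
Definition par_node (j : 'I_3) (p : 'I_(k + 3) -> nat) : set nat :=
  node_at (par_vec p) (p (rshift k j)).
Definition sigma_of := par_node ord0.
Definition theta_of := par_node (@Ordinal 3 1 isT).
Definition par_bound (p : 'I_(k + 3) -> nat) : nat := p (rshift k ord_max).

Definition mem_code (p : 'I_(k + 3) -> nat) (s j : nat) : Prop :=
  marked (sigma_of p) (theta_of p) (node_at (par_vec p) s) j.

(** The node [i] of the tree with parameter [b] is used as a counter: some path
above it jumps over all points of the set coded by [s]. *)
Definition reaches (p : 'I_(k + 3) -> nat) (b : 'I_k -> nat) (i s : nat) : Prop :=
  exists u, initial_segment (node_at b i) (node_at b u) /\
    forall y, mem_code p s y -> jumps_over (sigma_of p) (theta_of p) (node_at b u) y.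

(** Only counters below the bound are consulted, because the sparse sequence
decides the ranks of these only. *)
Definition eqcard_code (p : 'I_(k + 3) -> nat) (s t : nat) : Prop :=
  forall b, (forall j, ~ (par_bound p < b j)) -> forall i, ~ (par_bound p < i) ->
    reaches p b i s <-> reaches p b i t.

Lemma def_node_at n (b : 'I_k -> nat) i y : (forall j, b j < n) -> i < n -> y < n ->
  defpred Tr n (fun e => node_at (fun j => e (b j)) (e i) (e y)).
Proof. by move=> bn i_n yn; exact: (def_Tr Tr bn yn i_n). Qed.

Ltac def_step := first [apply: def_node_at; def_bound | def_logic].

Lemma def_mem_code n (p : 'I_(k + 3) -> nat) s j : (forall i, p i < n) ->
  s < n -> j < n -> defpred Tr n (fun e => mem_code (fun i => e (p i)) (e s) (e j)).
Proof.
move=> pn sn jn; rewrite /mem_code /marked /zone /line_point.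
rewrite /sigma_of /theta_of /par_node /par_vec.
by repeat def_step.
Qed.

Lemma def_initial_segment n (b : 'I_k -> nat) i (c : 'I_k -> nat) j :
  (forall l, b l < n) -> i < n -> (forall l, c l < n) -> j < n ->
  defpred Tr n (fun e => initial_segment (node_at (fun l => e (b l)) (e i))
                                         (node_at (fun l => e (c l)) (e j))).
Proof. by move=> ? ? ? ?; rewrite /initial_segment /subset; repeat def_step. Qed.

Lemma def_reaches n (p : 'I_(k + 3) -> nat) (b : 'I_k -> nat) i s :
  (forall j, p j < n) -> (forall j, b j < n) -> i < n -> s < n ->
  defpred Tr n (fun e => reaches (fun j => e (p j)) (fun j => e (b j)) (e i) (e s)).
Proof.
move=> pn bn i_n sn; rewrite /reaches /jumps_over /zone /line_point.
apply: def_ex; apply: def_and; first by apply: def_initial_segment.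
apply: def_all; apply: def_imp; first by apply: def_mem_code.
rewrite /sigma_of /theta_of /par_node /par_vec.
by repeat def_step.
Qed.

Lemma def_eqcard_code n (p : 'I_(k + 3) -> nat) s t : (forall i, p i < n) ->
  s < n -> t < n -> defpred Tr n (fun e => eqcard_code (fun i => e (p i)) (e s) (e t)).
Proof.
move=> pn sn tn; rewrite /eqcard_code /par_bound.
have hi i x : x < n -> i + x < i + n by rewrite ltn_add2l.
apply: def_allv; apply: def_imp.
  apply: def_all_ord => j; apply: def_not; apply: def_lt; first by apply: hi.
  exact: ltn_addr.
apply: def_all; apply: def_imp.
  by apply: def_not; apply: def_lt => //; rewrite ltnS; exact: hi.
apply: def_iff.
  apply: (def_reaches (p := fun j => (k + p j).+1) (b := fun j => j.+1)) => // *;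
    rewrite ltnS ?hi //.
  exact: ltn_addr.
apply: (def_reaches (p := fun j => (k + p j).+1) (b := fun j => j.+1)) => // *;
  rewrite ltnS ?hi //.
exact: ltn_addr.
Qed.

Hypothesis hTr : defines_family_of_trees Tr.

Let treeF b : is_tree (tree_at b).
Proof. exact: hTr. Qed.

(** Take counters of all exact ranks up to [M := L.+1] and a bound [c] for them,
then a sparse sequence starting beyond everything relevant to the nodes up to
[c].  In a tree with a node of rank [M], the paths [sigma] and [theta] and the
paths marking sets of points exist by [sparse_path].  A counter of rank exactly
[n] reaches the set coded by [s] if and only if this set has at most [n]
elements, so counters of all ranks up to [M] distinguish all cardinalities. *)
Lemma coding_of_ranks :
  (forall n, exists a t, rank_ge (tree_of Tr a) n t /\ ~ rank_ge (tree_of Tr a) n.+1 t) ->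
  forall L, exists p, set_coding mem_code eqcard_code p /\
    exists2 N, L <= N & has_card (fun j => exists s, mem_code p s j) N.
Proof.
move=> ranks L; pose M := L.+1.
have /choice[b bP] : forall n, exists b, exists i,
    rank_ge (tree_at b) n (node_at b i) /\ ~ rank_ge (tree_at b) n.+1 (node_at b i).
  move=> n; have [a [t [rt nrt]]] := ranks n; have := rank_ge_node (hTr a) rt.
  move=> [i _ it]; exists (tnth a), i; rewrite tree_at_tnth.
  suff -> : node_at (tnth a) i = t by [].
  by rewrite -it /node_at; have -> : [tuple tnth a j | j < k] = a
    by apply: eq_from_tnth => j; rewrite tnth_mktuple.
have /choice[i iP] := bP.
have [c cP] : exists c, forall n, n < M.+1 -> i n <= c /\ forall j, b n j <= c.
  apply: (@bounded_collection (fun n c => i n <= c /\ forall j, b n j <= c)).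
    by move=> n d d' dd' [id bd]; split=> [|j]; [|have := bd j]; lia.
  move=> n _; exists (i n + \sum_j b n j); split; first by lia.
  by move=> j; rewrite (bigD1 j) //=; lia.
have [g gP] := sparse_scale hTr.
(* v bounds the nodes up to c and, for each order, some fat extension of them *)
pose T := (k.-tuple 'I_c.+1 * 'I_c.+1 * 'I_M.+1)%type.
pose P (x : T) v :=
  let d := fun j => tnth x.1.1 j : nat in
  (forall y, node_at d x.1.2 y -> y < v) /\
  (rank_ge (tree_at d) x.2 (node_at d x.1.2) -> exists2 s, initial_segment (node_at d x.1.2) s &
     fat (tree_at d) x.2 s /\ forall y, s y -> y < v).
have [x d e de [Pd1 Pd2]|x|v vP] := @fin_collection T P.
- split=> [y /Pd1|/Pd2[s ns [fs sd]]]; first by lia.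
  by exists s => //; split=> // y /sd; lia.
- set d := fun j => tnth x.1.1 j : nat.
  have Fx : tree_at d (node_at d x.1.2) by exists (x.1.2 : nat).
  have [v1 v1P] := node_bound (treeF d) Fx.
  have [[s ns fs]|nr] := pselect (rank_ge (tree_at d) x.2 (node_at d x.1.2)); last first.
    by exists v1.
  have [v2 v2P] := node_bound (treeF d) (fat_node (treeF d) fs).
  exists (maxn v1 v2); split=> [y /v1P|_]; first by lia.
  by exists s => //; split=> // y /v2P; lia.
(* c and M are added because sparse_scale covers parameters and orders up to w0 *)
pose w0 := v + c + M.
have low d l n : (forall j, d j <= c) -> l <= c -> n <= M ->
    (forall y, node_at d l y -> y < w0) /\
    (rank_ge (tree_at d) n (node_at d l) -> exists2 s, initial_segment (node_at d l) s &
       fat (tree_at d) n s /\ forall y, s y -> y < w0).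
  move=> dc lc nM; have := vP ([tuple inord (d j) | j < k], inord l, inord n).
  rewrite /P /= !inordK ?ltnS //.
  have -> : (fun j => tnth [tuple inord (d j) : 'I_c.+1 | j < k] j : nat) = d.
    by apply/funext => j; rewrite tnth_mktuple inordK // ltnS.
  move=> [h1 h2]; split=> [y /h1|/h2[s ns [fs sv]]]; first by rewrite /w0; lia.
  by exists s => //; split=> // y /sv; rewrite /w0; lia.
pose w j := iter j g w0.
have wS j : w j < w j.+1 by have [] := gP (w j).
have w_ge j : w0 <= w j by apply: (sparse_le wS (leq0n j)).
have wP d j n s : (forall l, d l <= c) -> n <= M -> (forall x, s x -> x < w j) ->
    decides_jumps (tree_at d) (w j) (w j.+1) n s.
  move=> dc nM sw; have [_] := gP (w j); apply=> //.
    by move=> l; rewrite tnth_mktuple; have := dc l; have := w_ge j; rewrite /w0; lia.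
  by have := w_ge j; rewrite /w0; lia.
(* the tree of the node of rank M carries the coding *)
have [iMc bMc] := cP M (ltnSn M).
have [rM _] := iP M.
have [_ /(_ rM)[t nt [ft t0]]] := low _ _ M bMc iMc (leqnn M).
have path ks e : sorted ltn ks -> size ks <= M ->
    exists u, [/\ tree_at (b M) u, initial_segment t u &
     (forall x, u x -> t x \/ exists2 j, j \in [seq 4 * i + e | i <- ks] & w j < x < w j.+1) /\
     forall j, j \in [seq 4 * i + e | i <- ks] -> exists2 x, u x & w j < x < w j.+1].
  move=> srt sM.
  have [||||||u [Fu tu u1 u2]] := @sparse_path (tree_at (b M)) w M wS _
    [seq 4 * i + e | i <- ks] 0 t.
  - by move=> j n s; exact: wP.
  - exact: sorted_scale.
  - by apply/allP.
  - by rewrite size_map.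
  - exact: t0.
  - by rewrite size_map; apply: fat_le ft.
  - by exists u.
have srtL a : sorted ltn (iota a L.+1) by exact: iota_ltn_sorted.
have [|sg [[sgi _ sgE] tsg [sg1 sg2]]] := path _ 0 (srtL 0); first by rewrite size_iota.
have [|th [[thi _ thE] tth [th1 th2]]] := path _ 2 (srtL 0); first by rewrite size_iota.
have blk e j x : j \in [seq 4 * i + e | i <- iota 0 L.+1] -> w j < x < w j.+1 ->
    exists2 i, i <= L & w (4 * i + e) < x < w (4 * i + e).+1.
  by move=> /mapP[l]; rewrite mem_iota add0n ltnS => lL -> ?; exists l.
have blk' e l : l <= L -> 4 * l + e \in [seq 4 * i + e | i <- iota 0 L.+1].
  by move=> lL; apply: (map_f (fun i => 4 * i + e)); rewrite mem_iota add0n ltnS.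
pose sw := @sparse_le w wS.
have sgP x : sg x -> t x \/ exists2 j, j <= L & w (4 * j) < x < w (4 * j + 1).
  move=> /sg1[tx|[j jin xj]]; first by left.
  by right; have [l lL] := blk 0 j x jin xj; rewrite -addnS addn0; exists l.
have thP x : th x -> t x \/ exists2 j, j <= L & w (4 * j + 2) < x < w (4 * j + 3).
  move=> /th1[tx|[j jin xj]]; first by left.
  by right; have [l lL] := blk 2 j x jin xj; rewrite -addnS; exists l.
have thX j : j <= L -> exists2 x, th x & w (4 * j + 2) < x < w (4 * j + 3).
  by move=> /(blk' 2)/th2; rewrite -addnS.
have /choice[yk ykP] : forall j, exists y, j <= L ->
    [/\ sg y, w (4 * j) < y < w (4 * j + 1) & forall x, sg x -> w (4 * j) < x -> y <= x].
  move=> j; have [jL|] := leqP j L; last by exists 0.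
  have [x0 sx0 x0P] := sg2 _ (blk' 0 j jL); rewrite -addnS addn0 in x0P.
  have ex : exists x, `[< sg x /\ w (4 * j) < x >].
    by exists x0; apply/asboolP; split=> //; lia.
  case: (ex_minnP ex) => y /asboolP[sy wy] ymin; exists y => _; split=> //.
    by have /ymin : `[< sg x0 /\ w (4 * j) < x0 >] by [apply/asboolP; split=> //; lia]; lia.
  by move=> x sx wx; apply: ymin; apply/asboolP.
pose p (j : 'I_(k + 3)) := match fintype.split j with
  | inl l => b M l
  | inr l => nth 0 [:: sgi; thi; c] l end.
have pv : par_vec p = b M.
  by apply/funext => j; rewrite /par_vec /p (unsplitK (inl j)).
have pn (j : 'I_3) : p (rshift k j) = nth 0 [:: sgi; thi; c] j.
  by rewrite /p (unsplitK (inr j)).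
have sgp : sigma_of p = sg by rewrite /sigma_of /par_node pv pn.
have thp : theta_of p = th by rewrite /theta_of /par_node pv pn.
have cp : par_bound p = c by rewrite /par_bound pn.
pose pE := @pointE w L wS t sg th yk t0 tsg.1 sgP thP thX ykP.
(* the numbers of the points that belong to B *)
pose idx (B : nat -> Prop) := [seq j <- iota 1 L | `[< B (yk j) >]].
have idxP B j : j \in idx B <-> 0 < j <= L /\ B (yk j).
  rewrite mem_filter mem_iota; split=> [/andP[/asboolP ? ?]|[? ?]].
    by split=> //; lia.
  by apply/andP; split; [exact/asboolP|lia].
have idx_srt B : sorted ltn (idx B).
  by apply: sorted_filter; [exact: ltn_trans|exact: iota_ltn_sorted].
have idx_sz B : size (idx B) <= L.
  by rewrite size_filter; apply: leq_trans (count_size _ _) _; rewrite size_iota.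
have idxL B j : j \in idx B -> 0 < j <= L by move=> /idxP[].
have yklt := @yk_lt w L wS sg yk ykP.
have idx_card (B : nat -> Prop) : (forall y, B y -> line_point sg th y) ->
    has_card B (size (idx B)).
  move=> Bp; exists [seq yk j | j <- idx B]; split; last 1 first.
  - move=> y; split=> [By|/mapP[j /idxP[_ By] ->]//].
    have /pE[j jL yj] := Bp y By; apply/mapP; exists j => //.
    by apply/idxP; rewrite -yj.
  - rewrite map_inj_in_uniq; first exact: (sorted_uniq ltn_trans ltnn).
    move=> x y /idxL xL /idxL yL e.
    by have [xy|yx|//] := ltngtP x y; [have := yklt x y xy|have := yklt y x yx]; lia.
  - by rewrite size_map.
have memE s y : mem_code p s y <-> marked sg th (node_at (b M) s) y.
  by rewrite /mem_code sgp thp pv.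
have memp s y : mem_code p s y -> line_point sg th y by move=> /memE[].
have card_mem s : has_card (mem_code p s) (size (idx (mem_code p s))).
  by apply: idx_card; exact: memp.
have coded (B : nat -> Prop) : (forall y, B y -> line_point sg th y) ->
    exists s, forall y, mem_code p s y <-> B y.
  move=> Bp; have [|u [[s _ sE] tu mu]] := path (idx B) 3 (idx_srt B).
    exact: leq_trans (idx_sz B) _.
  exists s => y; rewrite memE (_ : node_at (b M) s = u) //.
  rewrite (@marker_marked w L wS t sg th yk t0 tsg.1 sgP thP thX ykP (idx B) t u (@idxL B) t0 mu).
  split=> [[j /idxP[_ By] ->]//|By]; have /pE[j jL yj] := Bp y By.
  by exists j => //; apply/idxP; rewrite -yj.
(* counters measure cardinality: rank_drop one way, a marking path the other *)
have reachE d l s : (forall j, d j <= c) -> l <= c ->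
    reaches p d l s <-> rank_ge (tree_at d) (size (idx (mem_code p s))) (node_at d l).
  move=> dc lc; set ks := idx _.
  have ksM : size ks <= M by apply: leq_trans (idx_sz _) _.
  have [n0 nfat] := low d l (size ks) dc lc ksM.
  split.
    move=> [u [lu ju]]; rewrite sgp thp in ju.
    apply: (@rank_drop w L wS t sg th yk t0 tsg.1 sgP thP thX ykP (tree_at d) M ks
      (node_at d l) (node_at d u)) => //.
    + by move=> j n s'; exact: wP.
    + exact: idx_srt.
    + exact: idxL.
    + by exists u.
    + by move=> j /idxP[_]; exact: ju.
  move=> /nfat[s' ns' [fs' s'0]].
  have [||||||u [Fu s'u u1 u2]] := @sparse_path (tree_at d) w M wS _ [seq 4 * i + 3 | i <- ks] 0 s'.
  - by move=> j n s''; exact: wP.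
  - exact/sorted_scale/idx_srt.
  - by apply/allP.
  - by rewrite size_map.
  - exact: s'0.
  - by rewrite size_map.
  have [ui _ uE] := Fu; exists ui; rewrite (_ : node_at d ui = u) // sgp thp.
  split; first exact: initial_segment_trans s'u.
  move=> y my; have /pE[j jL yj] := memp s y my; rewrite yj.
  apply: (@marker_jumps w L wS t sg th yk t0 tsg.1 sgP thP thX ykP ks s' u) => //.
  + exact: idxL.
  + by apply/idxP; rewrite -yj.
exists p; split.
  split.
  - exists (w (4 * L + 1)) => s y /memp/pE[j jL ->].
    have [|_ wj _] := ykP j; first by lia.
    by have := sw (4 * j + 1) (4 * L + 1); lia.
  - by move=> B Bm; apply: coded => y /Bm[s]; exact: memp.
  move=> s t'; split; last first.
    move=> [n cs ct] d dc l lc.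
    rewrite cp in dc lc.
    have {}dc j : d j <= c by rewrite leqNgt; apply/negP/dc.
    have {}lc : l <= c by rewrite leqNgt; apply/negP.
    by rewrite !reachE // (has_card_inj (card_mem s) cs) (has_card_inj (card_mem t') ct).
  move=> est; exists (size (idx (mem_code p s))) => //.
  (* the counter of rank exactly n reaches s1, hence s2, which has at most n points *)
  have le s1 s2 : eqcard_code p s1 s2 ->
      size (idx (mem_code p s2)) <= size (idx (mem_code p s1)).
    move=> e12; set n := size (idx (mem_code p s1)).
    have nM : n < M.+1 by apply: leq_ltn_trans (idx_sz _) _; rewrite /M.
    have [inc bnc] := cP n nM; have [rn nrn] := iP n.
    have := e12 (b n) _ (i n); rewrite cp !reachE // => /(_ _ _)[||+ _].
    - by move=> j; apply/negP; rewrite -leqNgt.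
    - by apply/negP; rewrite -leqNgt.
    move=> /(_ rn) r2; rewrite leqNgt; apply/negP => n2; apply: nrn.
    exact: rank_ge_le r2.
  have -> : size (idx (mem_code p s)) = size (idx (mem_code p t')).
    apply/eqP; rewrite eqn_leq !le //.
    by move=> d dc l lc; apply: iff_sym; exact: est.
  exact: card_mem.
exists (size (idx (line_point sg th))).
  suff -> : idx (line_point sg th) = iota 1 L by rewrite size_iota.
  apply/all_filterP/allP => j; rewrite mem_iota => jL; apply/asboolP/pE.
  by exists j => //; lia.
apply: has_card_ext (idx_card (line_point sg th) (fun y => id)) => y.
split=> [py|[s]]; last exact: memp.
have [//|s sP] := coded (line_point sg th).
by exists s; apply/sP.
Qed.

(** * Definable branches in the stable case *)

Ltac def_step' :=
  first [apply: def_initial_segment; def_bound | def_step].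

Lemma node_at_tree b i : tree_at b (node_at b i).
Proof. by exists i. Qed.

Lemma tree_at_node b t : tree_at b t -> exists i, t = node_at b i.
Proof. by move=> [i _ <-]; exists i. Qed.

(** Sets that are fat, or have a rank, are nodes, so quantification over sets can
be replaced by quantification over their indices. *)
Lemma def_fat m n (b : 'I_k -> nat) i : (forall l, b l < n) -> i < n ->
  defpred Tr n (fun e => fat (tree_at (fun l => e (b l))) m (node_at (fun l => e (b l)) (e i))).
Proof.
elim: m n b i => [|m IH] n b i bn i_n.
  by apply: def_ext (def_true Tr n) => e; split=> // _; exact: node_at_tree.
apply: (@def_ext _ _ _ _ (fun e => forall x, exists j,
  ((initial_segment (node_at (fun l => e (b l)) (e i)) (node_at (fun l => e (b l)) j) /\
   ((exists y, node_at (fun l => e (b l)) j y /\ ~ node_at (fun l => e (b l)) (e i) y) /\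
   forall y, node_at (fun l => e (b l)) j y -> ~ node_at (fun l => e (b l)) (e i) y -> x < y)) /\
   fat (tree_at (fun l => e (b l))) m (node_at (fun l => e (b l)) j)))).
  move=> e; split=> h x.
    have [u [tu [y uy ty] xu] fu] := h x.
    have [j uj] := tree_at_node (fat_node (treeF _) fu); subst u.
    by exists j; split=> //; split=> //; split=> //; exists y.
  have [j [[tu [[y [uy ty]] xu]] fu]] := h x.
  by exists (node_at (fun l => e (b l)) j) => //; split=> //; exists y.
apply: def_all; apply: def_ex; apply: def_and; first by repeat def_step'.
exact: (IH _ (fun l => (b l).+2) 0).
Qed.

Lemma def_rank_ge m n (b : 'I_k -> nat) i : (forall l, b l < n) -> i < n ->
  defpred Tr n (fun e => rank_ge (tree_at (fun l => e (b l))) m (node_at (fun l => e (b l)) (e i))).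
Proof.
move=> bn i_n; apply: (@def_ext _ _ _ _ (fun e => exists j,
   initial_segment (node_at (fun l => e (b l)) (e i)) (node_at (fun l => e (b l)) j) /\
   fat (tree_at (fun l => e (b l))) m (node_at (fun l => e (b l)) j))).
  move=> e; split=> [[u tu fu]|[j [tu fu]]].
    by have [j uj] := tree_at_node (fat_node (treeF _) fu); subst u; exists j.
  by exists (node_at (fun l => e (b l)) j).
apply: def_ex; apply: def_and; first by repeat def_step'.
exact: (@def_fat m n.+1 (fun l => (b l).+1) 0).
Qed.

Lemma def_unbounded m n (b : 'I_k -> nat) i : (forall l, b l < n) -> i < n ->
  defpred Tr n (fun e => unbounded_above (tree_at (fun l => e (b l))) m
                           (node_at (fun l => e (b l)) (e i))).
Proof.
move=> bn i_n; apply: (@def_ext _ _ _ _ (fun e => forall x, exists j,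
   (initial_segment (node_at (fun l => e (b l)) (e i)) (node_at (fun l => e (b l)) j) /\
    (exists y, node_at (fun l => e (b l)) j y /\ x < y)) /\
   rank_ge (tree_at (fun l => e (b l))) m (node_at (fun l => e (b l)) j))).
  move=> e; split=> h x.
    have [u [tu ru [y uy xy]]] := h x.
    have [j uj] := tree_at_node (rank_ge_node (treeF _) ru); subst u.
    by exists j; split=> //; split=> //; exists y.
  have [j [[tu [y [uy xy]]] ru]] := h x.
  by exists (node_at (fun l => e (b l)) j); split=> //; exists y.
apply: def_all; apply: def_ex; apply: def_and; first by repeat def_step'.
exact: (@def_rank_ge m n.+2 (fun l => (b l).+2) 0).
Qed.

Definition extendable (b : 'I_k -> nat) (j i : nat) : set (set nat) :=
  [set t | [/\ tree_at b t, initial_segment (node_at b i) t & unbounded_above (tree_at b) j t]].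

Definition greedy_set (b : 'I_k -> nat) (j i : nat) : set nat :=
  \bigcup_(t in greedy (extendable b j i)) t.

Lemma def_extendable m n (b : 'I_k -> nat) s i : (forall l, b l < n) -> s < n -> i < n ->
  defpred Tr n (fun e => extendable (fun l => e (b l)) m (e s) (node_at (fun l => e (b l)) (e i))).
Proof.
move=> bn sn i_n; apply: (@def_ext _ _ _ _ (fun e =>
   initial_segment (node_at (fun l => e (b l)) (e s)) (node_at (fun l => e (b l)) (e i)) /\
   unbounded_above (tree_at (fun l => e (b l))) m (node_at (fun l => e (b l)) (e i)))).
  by move=> e; split=> [[_ ? ?]//|[? ?]]; split=> //; exact: node_at_tree.
by apply: def_and; [repeat def_step'|exact: def_unbounded].
Qed.

Lemma def_greedy_set m n (b : 'I_k -> nat) s y : (forall l, b l < n) -> s < n -> y < n ->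
  defpred Tr n (fun e => greedy_set (fun l => e (b l)) m (e s) (e y)).
Proof.
move=> bn sn yn; apply: (@def_ext _ _ _ _ (fun e => exists i,
   node_at (fun l => e (b l)) i (e y) /\
   ((exists u, extendable (fun l => e (b l)) m (e s) (node_at (fun l => e (b l)) u) /\
      initial_segment (node_at (fun l => e (b l)) i) (node_at (fun l => e (b l)) u)) /\
   forall v, extendable (fun l => e (b l)) m (e s) (node_at (fun l => e (b l)) v) ->
     forall z z', node_at (fun l => e (b l)) i z -> z' < z -> ~ node_at (fun l => e (b l)) i z' ->
     node_at (fun l => e (b l)) v z' ->
     exists x, x < z' /\ ~ (node_at (fun l => e (b l)) v x <-> node_at (fun l => e (b l)) i x)))).
  move=> e; split.
    move=> [t [[u Eu tu] gt] ty].
    have [i ti] : exists i, t = node_at (fun l => e (b l)) i.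
      by apply: tree_at_node; have [Fu _ _] := Eu; exact: (treeF _).2 tu.
    have [j uj] : exists j, u = node_at (fun l => e (b l)) j.
      by apply: tree_at_node; have [] := Eu.
    subst t u; exists i; split=> //; split; first by exists j.
    move=> v Ev z z' tz zz' tz' vz'.
    by have [x xz nx] := gt z z' _ tz zz' tz' Ev vz'; exists x.
  move=> [i [iy [[u [Eu iu]] gt]]]; exists (node_at (fun l => e (b l)) i) => //.
  split; first by exists (node_at (fun l => e (b l)) u).
  move=> z z' v tz zz' tz' Ev vz'.
  have [j vj] : exists j, v = node_at (fun l => e (b l)) j by apply: tree_at_node; have [] := Ev.
  by subst v; have [x [xz nx]] := gt j Ev z z' tz zz' tz' vz'; exists x.
apply: def_ex; apply: def_and; first by repeat def_step'.
apply: def_and.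
  apply: def_ex; apply: def_and; last by repeat def_step'.
  exact: (@def_extendable m n.+2 (fun l => (b l).+2) s.+2 0).
apply: def_all; apply: def_imp; last by repeat def_step'.
exact: (@def_extendable m n.+2 (fun l => (b l).+2) s.+2 0).
Qed.

Variable N : nat.
Hypothesis stable : forall b t, rank_ge (tree_at b) N t -> rank_ge (tree_at b) N.+1 t.

(** Stability is what replaces the first clause of [branch_seed] when [j] is [N]. *)
Lemma seed_branch b j i : j <= N -> branch_seed (tree_at b) N j (node_at b i) ->
  infinite_branch (tree_at b) (greedy_set b j i).
Proof.
move=> jN [nr unb]; apply: (@greedy_branch _ _ (node_at b i)) => //.
- by move=> t [].
- by split=> //; [exact: node_at_tree|exact: initial_segment_refl].
- move=> t [Ft it ut].
  have [u [tu new uu]] : exists u, [/\ initial_segment t u, (exists2 y, u y & ~ t y)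
      & unbounded_above (tree_at b) j u].
    apply: (@unbounded_extension (tree_at b) (treeF b) j (node_at b i) t) => //.
    by move: jN; rewrite leq_eqVlt => /orP[/eqP->|/nr ?]; [right; exact: stable|left].
  exists u; split=> //; split=> //; last exact: initial_segment_trans tu.
  by have [u' [uu' ru' _]] := uu 0; apply: (treeF b).2 uu'; exact: rank_ge_node ru'.
Qed.

Lemma branch_iff_seed b : (exists X, infinite_branch (tree_at b) X) <->
  exists2 j, j < N.+1 & exists i, branch_seed (tree_at b) N j (node_at b i).
Proof.
split=> [[X /(branch_seed_ex N (treeF b))[j jN [s /tree_at_node[i ->] seed]]]|].
  by exists j => //; exists i.
by move=> [j jN [i seed]]; exists (greedy_set b j i); exact: seed_branch.
Qed.

Lemma def_branch : defpred Tr k (fun e =>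
  exists X, infinite_branch (tree_at (fun l : 'I_k => e l)) X).
Proof.
apply: def_ext (fun e => branch_iff_seed (fun l : 'I_k => e l)) _.
apply: def_exn => j; apply: def_ex.
have bn (l : 'I_k) : l.+1 < k.+1 by rewrite ltnS.
apply: def_and; last exact: (@def_unbounded j k.+1 (fun l : 'I_k => l.+1) 0).
apply: def_imp; first exact: def_const.
by apply: def_not; exact: (@def_rank_ge j.+1 k.+1 (fun l : 'I_k => l.+1) 0).
Qed.

Lemma definable_greedy_set b j i : definable_set Tr (greedy_set b j i).
Proof.
suff [phi [fr h]] : defpred Tr 1 (fun e => greedy_set b j i (e 0)).
  by exists phi; split=> // v; rewrite -h /thead (tnth_nth 0).
apply: (@def_subst_num k Tr 1 k b (fun c e => greedy_set c j i (e 0))).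
rewrite addn1.
apply: (@def_subst_num k Tr k.+1 1 (fun=> i)
  (fun c e => greedy_set (fun l : 'I_k => e l) j (c ord0) (e (k + 0)))).
apply: (@def_greedy_set j (1 + k.+1) (fun l : 'I_k => 1 + l) 0 (1 + (k + 0))) => [l||]; try lia.
by have := ltn_ord l; lia.
Qed.

End Trees.

Theorem mainTheorem1 (k : nat) (Tr : k.-tuple nat -> nat -> nat -> Prop)
    (hTr : defines_family_of_trees Tr) (hdec : decidable_theory Tr) :
  definable Tr (fun a : k.-tuple nat =>
    exists X : set nat, infinite_branch (tree_of Tr a) X) /\
  (forall a : k.-tuple nat,
     (exists X : set nat, infinite_branch (tree_of Tr a) X) ->
     exists X : set nat, infinite_branch (tree_of Tr a) X /\ definable_set Tr X).
Proof.
have [N stable] : exists N, forall b t,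
    rank_ge (tree_at Tr b) N t -> rank_ge (tree_at Tr b) N.+1 t.
  apply: contrapT => /forallNP unstable.
  apply: (@undecidable_of_coding k Tr (k + 3) (mem_code Tr) (eqcard_code Tr)) hdec.
  - by move=> *; exact: def_mem_code.
  - by move=> *; exact: def_eqcard_code.
  apply: coding_of_ranks hTr _ => n.
  have /existsNP[b /existsNP[t /not_implyP[rt nrt]]] := unstable n.
  by exists [tuple b j | j < k], t.
split.
  have [phi [fr h]] := def_branch hTr stable; exists phi; split=> // v; rewrite -h.
  suff -> : tree_at Tr (fun l : 'I_k => nth 0 v l) = tree_of Tr v by [].
  by rewrite -tree_at_tnth; congr (tree_at Tr); apply/funext => l; rewrite (tnth_nth 0).
move=> a; rewrite -tree_at_tnth => /(branch_iff_seed hTr stable)[j jN [i seed]].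
exists (greedy_set Tr (tnth a) j i); split; first exact: seed_branch seed.
exact: definable_greedy_set.
Qed.
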